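(* For any topological space $X$, with the premetric space $\mathsf{D}X$, the metric space $\mathsf{E}X=\circledast^\omega(\mathsf{D}X)$, the sequential coreflexion $\mathsf{s}X$ and the resolution map $\xi_X:\mathsf{E}X\to \mathsf{s}X$ defined in the context: \begin{enumerate} \item $\mathsf{E}X$ is an economical complete metric space of cardinality $|\mathsf{E}X|\le \mathfrak{c}\cdot |X|^{\omega}$; \item the map $\xi_X:\mathsf{E}X\to \mathsf{s}X$ is a monotone quotient surjection; \item the space $\mathsf{E}X$ is connected if and only if the sequential coreflexion $\mathsf{s}X$ of $X$ is connected; \item the map $\xi_X:\mathsf{E}X\to X$ is quotient if and only if the space $X$ is sequential; \item the map $\xi_X:\mathsf{E}X\to X$ is hereditarily quotient if and only if $X$ is Fr\'echet-Urysohn; \item each point $a\in \mathsf{E}X$ has a neighborhood $U_a\subset \mathsf{E}X$ whose image $\xi_X(U_a)$ lies in a convergent sequence in $X$. \end{enumerate}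
   Context: Topological notions. A surjective map $f:X\to Y$ between topological spaces is monotone if $f^{-1}(y)$ is connected for every $y\in Y$; quotient if $U\subset Y$ is open iff $f^{-1}(U)$ is open in $X$; hereditarily quotient if for every $A\subset Y$ the restriction $f|f^{-1}(A):f^{-1}(A)\to A$ is a quotient map (subspace topologies). A space $X$ is sequential if for each non-closed $A\subset X$ there is a sequence in $A$ converging to a point of $X\setminus A$; Fr\'echet-Urysohn if for each $A\subset X$ and $x\in \overline{A}$ there is a sequence in $A$ converging to $x$. A subset $V\subset X$ is sequentially open if for each sequence $(x_n)$ in $X$ converging to a point of $V$ there is $n$ with $x_m\in V$ for all $m\ge n$. The sequentially open subsets form a topology; $X$ endowed with it is the sequential coreflexion $\mathsf{s}X$. Let $S_0=\{0\}\cup\{\frac1n:n\in\mathbb{N}\}\subset\mathbb{R}$, $\mathbb N=\{1,2,\dots\}$; a convergent sequence in $X$ means the image $f(S_0)$ of $S_0$ under a continuous map $f:S_0\to X$. The density is $\mathrm{dens}(A)=\min\{|D|:D\subset A\subset\overline D\}$. A metric space $(M,d)$ is economical if $|d(A\times A)|\le\mathrm{dens}(A)$ for each infinite $A\subset M$, where $d(A\times A)=\{d(a,b):a,b\in A\}$. $\mathfrak c$ is the cardinality of the continuum. Premetric spaces. A premetric on a set $X$ is a function $d_X:X\times X\to[0,\infty)$ with $d_X(x,x)=0$ for all $x$. Its topology: $U\subset X$ is open iff for each $x\in U$ there is $r>0$ with $\{y\in X:d_X(x,y)<r\}\subset U$. Put $\bar d_X=\min\{1,d_X\}$. Sequential decomposition.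 For a topological space $X$, $\mathsf{D}X=C(S_0,X)\times S_0$, where $C(S_0,X)$ is the set of continuous maps $S_0\to X$, with the premetric $d_{\mathsf{D}X}((f,t),(g,s))=0$ if $f(t)=g(s)$; $=|t-s|$ if $f(t)\neq g(s)$ but $f=g$; $=1$ otherwise. The calculation map is $c_X:\mathsf{D}X\to X$, $c_X(f,t)=f(t)$; it is also regarded as a map to $\mathsf{s}X$. Complete oriented graph. For a set $X$, $\Gamma X=X\cup\{(x,y,t)\in X\times X\times(0,1):x\ne y\}$. For $x,y\in X$, $t\in[0,1]$ put $\langle x,y,t\rangle=(x,y,t)$ if $x\neq y$ and $t\in(0,1)$; $=x$ if $x=y$ or $t=0$; $=y$ if $t=1$. For $x\ne y$ let $[x,y]=\{\langle x,y,t\rangle:t\in[0,1]\}$ (the edges $[x,y]$ and $[y,x]$ meet only in $\{x,y\}$), with $\tilde d_{\Gamma X}(\langle x,y,t\rangle,\langle x,y,s\rangle)=|t-s|$. The metric $d_{\Gamma X}(a,b)$ is the minimum of the sums $\sum_{i=1}^n\tilde d_{\Gamma X}(a_{i-1},a_i)$ over chains $a=a_0,a_1,\dots,a_n=b$ such that for each $i$ the points $a_{i-1},a_i$ lie on a common edge (and $d_{\Gamma X}(a,a)=0$). Cobweb. For a premetric space $X$, $\circledast X=\{\langle x,y,t\rangle\in\Gamma X: t\le 1-\bar d_X(y,x)\}\subset\Gamma X$ with the metric $d_{\circledast X}$ restricted from $d_{\Gamma X}$; $X\subset\circledast X$ as the set of vertices. The compression map $\pi_X:\circledast X\to X$ is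 $\pi_X(a)=a$ if $a\in X$ and $\pi_X(a)=x$ if $a=(x,y,t)\in\circledast X\setminus X$. Iterated cobweb. $\circledast^1X=\circledast X$, $\circledast^{n+1}X=\circledast(\circledast^nX)$, and $\circledast^\omega X=\{(x_n)_{n\in\mathbb N}\in\prod_{n\in\mathbb N}\circledast^nX:\pi_{\circledast^nX}(x_{n+1})=x_n \text{ for all } n\in\mathbb N\}$ with the metric $d_{\circledast^\omega X}((a_n),(b_n))=\max_{n\in\mathbb N}\frac1n d_{\circledast^nX}(a_n,b_n)$. Let $\pi_1^\omega:\circledast^\omega X\to\circledast X$, $(x_n)\mapsto x_1$, and $\pi_X^\omega=\pi_X\circ\pi_1^\omega:\circledast^\omega X\to X$. Economical resolution. For a topological space $X$, $\mathsf{E}X=\circledast^\omega(\mathsf{D}X)$ and $\xi_X=c_X\circ\pi^\omega_{\mathsf{D}X}$, regarded as a map $\mathsf{E}X\to\mathsf{s}X$ or $\mathsf{E}X\to X$ (the same underlying function, with the topology of $\mathsf sX$ or of $X$ on the target). *)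

(* Defs.v *)
From HB Require Import structures.
From mathcomp Require Import all_boot all_order all_algebra.
From mathcomp Require Import all_classical all_reals all_analysis.
From mathcomp Require Import lra.

Set Implicit Arguments.
Unset Strict Implicit.
Unset Printing Implicit Defensive.

Import Order.TTheory GRing.Theory Num.Theory.
Import numFieldNormedType.Exports.

Local Open Scope classical_set_scope.
Local Open Scope ring_scope.
Local Open Scope card_scope.

Section maps.
Context {X Y : topologicalType}.

Definition surjective_map (f : X -> Y) := forall y, exists x, f x = y.

Definition monotone_map (f : X -> Y) :=
  surjective_map f /\ forall y, connected (f @^-1` [set y]).

Definition quotient_map (f : X -> Y) :=
  surjective_map f /\ forall U : set Y, open U <-> open (f @^-1` U).

End maps.

Section hereditarily_quotient.
Context {X Y : topologicalType} (f : X -> Y).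

Fact restr_subproof (A : set Y) (x : f @^-1` A) : f (\val x) \in A.
Proof. by apply/mem_set; exact: (set_valP x). Qed.

(* [f @^-1` A] and [A], used as types, carry the subspace topologies *)
Definition restr (A : set Y) (x : f @^-1` A) : A :=
  exist _ (f (\val x)) (restr_subproof x).

Definition hereditarily_quotient_map :=
  surjective_map f /\ forall A : set Y, quotient_map (@restr A).

End hereditarily_quotient.

Definition sequential_space (X : topologicalType) := forall A : set X,
  ~ closed A -> exists u : nat -> X, exists x : X,
    [/\ forall n, A (u n), ~ A x & u @ \oo --> x].

Definition Frechet_Urysohn_space (X : topologicalType) :=
  forall (A : set X) (x : X), closure A x ->
  exists u : nat -> X, (forall n, A (u n)) /\ u @ \oo --> x.

Definition sequentially_open (X : topologicalType) (V : set X) :=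
  forall (u : nat -> X) (x : X), V x -> u @ \oo --> x ->
  exists n, forall m, (n <= m)%N -> V (u m).

Definition seq_coreflexion (X : topologicalType) : Type := X.

Section seq_coreflexion.
Context (X : topologicalType).

HB.instance Definition _ := Choice.on (seq_coreflexion X).

Let opT : sequentially_open [set: X].
Proof. by move=> u x _ _; exists 0%N. Qed.

Let opI : setI_closed (@sequentially_open X).
Proof.
move=> A B oA oB u x [Ax Bx] ux.
have [n An] := oA u x Ax ux; have [m Bm] := oB u x Bx ux.
exists (maxn n m) => k; rewrite geq_max => /andP[nk mk].
by split; [exact: An|exact: Bm].
Qed.

Let op_bigU (I : Type) (f : I -> set X) :
  (forall i, sequentially_open (f i)) -> sequentially_open (\bigcup_i f i).
Proof.
move=> of_ u x [i _ fix_] ux; have [n fn] := of_ i u x fix_ ux.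
by exists n => m nm; exists i => //; exact: fn.
Qed.

HB.instance Definition _ := isOpenTopological.Build (seq_coreflexion X)
  opT opI op_bigU.

End seq_coreflexion.

Definition S0 (R : realType) : set R :=
  [set 0] `|` [set (n.+1%:R)^-1 | n in [set: nat]].

Arguments S0 : clear implicits.

Definition convergent_sequence (R : realType) (X : topologicalType)
    (C : set X) :=
  exists f : continuousType (S0 R) X, C = range f.

Definition dense_subset (T : topologicalType) (A D : set T) :=
  D `<=` A /\ A `<=` closure D.

(* Cardinals are represented by sets: [dens A] is a dense subset of [A] of
   least cardinality. *)
Definition dens (T : topologicalType) (A : set T) : set T :=
  xget set0 [set D | dense_subset A D /\
                     forall D', dense_subset A D' -> D #<= D'].

Definition economical (R : realType) (M : metricType R) :=
  forall A : set M, infinite_set A ->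
    [set mdist p.1 p.2 | p in A `*` A] #<= dens A.

(* [cauchy_cvg] of [completeType], for a type that need not be pointed *)
Definition complete_space (T : uniformType) :=
  forall F : set_system T, ProperFilter F -> cauchy F -> exists l : T, F --> l.

Record premetric (R : realType) := Premetric {
  pcarrier :> Type;
  pdist : pcarrier -> pcarrier -> R;
  pdist_ge0 : forall x y, 0 <= pdist x y;
  pdistxx : forall x, pdist x x = 0 }.

Arguments pdist {R p}.

Section sequential_decomposition.
Context (R : realType) (X : topologicalType).

Definition decomp_carrier : Type := (continuousType (S0 R) X * S0 R)%type.

Definition decomp_dist (a b : decomp_carrier) : R :=
  if pselect (a.1 a.2 = b.1 b.2) then 0
  else if pselect (a.1 = b.1) then `|\val a.2 - \val b.2|
  else 1.

Fact decomp_dist_ge0 a b : 0 <= decomp_dist a b.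
Proof. by rewrite /decomp_dist; do 2 case: pselect => [?|?] //. Qed.

Fact decomp_distxx a : decomp_dist a a = 0.
Proof. by rewrite /decomp_dist; case: pselect. Qed.

Definition decomp : premetric R := Premetric decomp_dist_ge0 decomp_distxx.

Definition calc (a : decomp) : X := a.1 a.2.

End sequential_decomposition.

Inductive graph (R : realType) (X : Type) : Type :=
| Vertex of X
| Inner (x y : X) (t : R) of x <> y & 0 < t < 1.

Arguments Vertex {R X}.
Arguments Inner {R X}.

Section graph.
Context {R : realType} {X : Type}.
Local Notation G := (graph R X).

(* The point <x, y, t>; only [0 <= t <= 1] is meaningful. *)
Definition edge_point (x y : X) (t : R) : G :=
  match pselect (x = y) with
  | left _ => Vertex x
  | right xy =>
    match @idP (0 < t < 1) with
    | ReflectT t01 => Inner x y t xy t01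
    | ReflectF _ => if t <= 0 then Vertex x else Vertex y
    end
  end.

(* [edge_dist a b r]: a and b lie on a common edge, at distance r on it *)
Inductive edge_dist : G -> G -> R -> Prop :=
| EdgeDist x y t s : x <> y -> 0 <= t <= 1 -> 0 <= s <= 1 ->
    edge_dist (edge_point x y t) (edge_point x y s) `|t - s|.

(* [chain a b r]: some chain from a to b has length r *)
Inductive chain : G -> G -> R -> Prop :=
| chain_nil a : chain a a 0
| chain_cons a b c r s :
    edge_dist a b r -> chain b c s -> chain a c (r + s).

(* The infimum is a minimum: it suffices to consider chains that have at most
   two vertices between their ends, and these have finitely many lengths. *)
Definition graph_dist (a b : G) : R := inf [set r | chain a b r].

Lemma edge_point0 x y : edge_point x y 0 = Vertex x.
Proof.
rewrite /edge_point; case: pselect => // ?.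
case: {-}_ / idP => [t01|_]; last by rewrite lexx.
by exfalso; move: (t01); rewrite ltxx.
Qed.

Lemma edge_point1 x y : edge_point x y 1 = Vertex y.
Proof.
rewrite /edge_point; case: pselect => [->//|?].
case: {-}_ / idP => [t01|_]; last by rewrite leNgt ltr01.
by exfalso; move: (t01); rewrite ltxx andbF.
Qed.

Lemma edge_point_inner x y t (xy : x <> y) (t01 : 0 < t < 1) :
  edge_point x y t = Inner x y t xy t01.
Proof.
rewrite /edge_point; case: pselect => // xy'; rewrite (Prop_irrelevance xy' xy).
by case: {-}_ / idP => [t01'|//]; rewrite (Prop_irrelevance t01' t01).
Qed.

Lemma edge_pointP x y t : x <> y -> 0 <= t <= 1 ->
  [\/ t = 0 /\ edge_point x y t = Vertex x,
      t = 1 /\ edge_point x y t = Vertex y |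
      exists xy t01, edge_point x y t = Inner x y t xy t01].
Proof.
move=> xy /andP[]; rewrite le_eqVlt => /predU1P[<- _|t0].
  by constructor 1; rewrite edge_point0.
rewrite le_eqVlt => /predU1P[->|t1]; first by constructor 2; rewrite edge_point1.
have t01 : 0 < t < 1 by rewrite t0.
by constructor 3; exists xy, t01; exact: edge_point_inner.
Qed.

Lemma edge_dist_sym a b r : edge_dist a b r -> edge_dist b a r.
Proof. by case=> x y t s xy t01 s01; rewrite distrC; constructor. Qed.

Lemma edge_dist_ge0 a b r : edge_dist a b r -> 0 <= r.
Proof. by case. Qed.

Lemma chain_ge0 a b r : chain a b r -> 0 <= r.
Proof.
by elim=> // {}a {}b c {}r s /edge_dist_ge0 r0 _ s0; rewrite addr_ge0.
Qed.

Lemma chain_trans a b c r s : chain a b r -> chain b c s -> chain a c (r + s).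
Proof.
move=> ab; elim: ab s => [{}a s|{}a {}b d {}r t ab _ IH s dc].
  by rewrite add0r.
by rewrite -addrA; apply: chain_cons ab _; exact: IH.
Qed.

Lemma chain1 a b r : edge_dist a b r -> chain a b r.
Proof. by move=> ab; rewrite -[r]addr0; apply: chain_cons ab (chain_nil _). Qed.

Lemma chain_sym a b r : chain a b r -> chain b a r.
Proof.
elim=> [{}a|{}a {}b c {}r s ab _ IH]; first exact: chain_nil.
by rewrite addrC; apply: (chain_trans IH); exact/chain1/edge_dist_sym.
Qed.

Lemma chain_vertex a : exists x, exists2 r, chain a (Vertex x) r & r <= 1.
Proof.
case: a => [x|x y t xy t01]; first by exists x, 0; [exact: chain_nil|].
exists x, `|t - 0|.
  rewrite -(edge_point_inner xy t01) -(edge_point0 x y).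
  by apply/chain1; constructor => //; lra.
by rewrite subr0 ger0_norm; lra.
Qed.

Lemma chain_vertices x y :
  exists2 r, chain (Vertex x) (Vertex y) r & r <= 1.
Proof.
have [->|xy] := pselect (x = y); first by exists 0; [exact: chain_nil|].
exists `|0 - 1|; last by rewrite sub0r normrN normr1.
rewrite -{1}(edge_point0 x y) -(edge_point1 x y).
by apply/chain1; constructor => //; lra.
Qed.

Lemma chain_exists a b : exists2 r, chain a b r & r <= 3.
Proof.
have [x [r ax r1]] := chain_vertex a; have [y [s bx s1]] := chain_vertex b.
have [u xy u1] := chain_vertices x y.
exists (r + (u + s)); last by lra.
by apply: (chain_trans ax); apply: (chain_trans xy); exact: chain_sym.
Qed.

Let chain_has_inf a b : has_inf [set r | chain a b r].
Proof.
split; first by have [r ? _] := chain_exists a b; exists r.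
by exists 0 => r /chain_ge0.
Qed.

Lemma graph_dist_le a b r : chain a b r -> graph_dist a b <= r.
Proof. by move=> ab; apply: ge_inf => //; case: (chain_has_inf a b). Qed.

Lemma graph_dist_ge a b m :
  (forall r, chain a b r -> m <= r) -> m <= graph_dist a b.
Proof.
by move=> mP; apply: lb_le_inf; [case: (chain_has_inf a b)|exact: mP].
Qed.

Lemma graph_dist_ge0 a b : 0 <= graph_dist a b.
Proof. by apply: graph_dist_ge => r /chain_ge0. Qed.

Lemma graph_dist_le3 a b : graph_dist a b <= 3.
Proof.
by have [r ab r3] := chain_exists a b; exact: le_trans (graph_dist_le ab) r3.
Qed.

Lemma graph_distxx a : graph_dist a a = 0.
Proof.
apply/eqP; rewrite eq_le graph_dist_ge0 andbT.
exact: graph_dist_le (chain_nil a).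
Qed.

Lemma graph_dist_sym a b : graph_dist a b = graph_dist b a.
Proof.
by congr inf; apply/seteqP; split=> r /=; exact: chain_sym.
Qed.

Lemma graph_dist_triangle b a c :
  graph_dist a c <= graph_dist a b + graph_dist b c.
Proof.
rewrite -lerBlDr; apply: graph_dist_ge => r ab.
rewrite lerBlDr addrC -lerBlDr; apply: graph_dist_ge => s bc.
by rewrite lerBlDr addrC; exact/graph_dist_le/(chain_trans ab bc).
Qed.

Lemma graph_dist_lipschitz (phi : G -> R) :
  (forall x y t s, x <> y -> 0 <= t <= 1 -> 0 <= s <= 1 ->
    `|phi (edge_point x y t) - phi (edge_point x y s)| <= `|t - s|) ->
  forall a b, `|phi a - phi b| <= graph_dist a b.
Proof.
move=> phiP a b; apply: graph_dist_ge => r.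
elim=> [{}a|{}a {}b c {}r s ab _ IH]; first by rewrite subrr normr0.
rewrite -(subrKA (phi b)); apply: le_trans (ler_normD _ _) _.
by apply: lerD => //; case: ab => *; exact: phiP.
Qed.

(* 1-Lipschitz functions separating a vertex, or an inner point, from the
   other points *)
Let tentV (v : X) (a : G) : R :=
  match a with
  | Vertex u => (`[< u = v >])%:R
  | Inner x y t _ _ => if `[< x = v >] then 1 - t
                       else if `[< y = v >] then t else 0
  end.

Let tentVE v x y t : x <> y -> 0 <= t <= 1 -> tentV v (edge_point x y t) =
  if `[< x = v >] then 1 - t else if `[< y = v >] then t else 0.
Proof.
move=> xy /(edge_pointP xy)[[-> ->]|[-> ->]|[? [? ->]]] //=.
  by rewrite subr0 if_same; case: (asboolP (x = v)).
rewrite subrr; case: (asboolP (x = v)) => [xv|_]; last by case: asboolP.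
by case: asboolP => // yv; case: xy; rewrite xv.
Qed.

Let tentI (x0 y0 : X) (t0 : R) (a : G) : R :=
  match a with
  | Vertex _ => 0
  | Inner x y t _ _ => if `[< x = x0 >] && `[< y = y0 >]
      then Num.max 0 (Num.min t0 (1 - t0) - `|t - t0|) else 0
  end.

Let tentIE x0 y0 t0 x y t : 0 < t0 < 1 -> x <> y -> 0 <= t <= 1 ->
  tentI x0 y0 t0 (edge_point x y t) = if `[< x = x0 >] && `[< y = y0 >]
      then Num.max 0 (Num.min t0 (1 - t0) - `|t - t0|) else 0.
Proof.
move=> /andP[t00 t01] xy /(edge_pointP xy)[[-> ->]|[-> ->]|[? [? ->]]] //=;
  case: ifP => // _; rewrite max_l// subr_le0.
  by rewrite sub0r normrN ger0_norm ?(ltW t00)// ge_min lexx.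
by rewrite ger0_norm ?subr_ge0 ?(ltW t01)// ge_min lexx orbT.
Qed.

Let graph_distV v b : graph_dist (Vertex v) b = 0 -> Vertex v = b.
Proof.
have tentVL x y t s : x <> y -> 0 <= t <= 1 -> 0 <= s <= 1 ->
    `|tentV v (edge_point x y t) - tentV v (edge_point x y s)| <= `|t - s|.
  move=> xy t01 s01; rewrite !tentVE//; case: ifP => _; last case: ifP => _ //.
    by rewrite [leRHS]distrC opprB addrC subrKA.
  by rewrite subrr normr0.
move=> vb0; have := graph_dist_lipschitz tentVL (Vertex v) b.
rewrite vb0 normr_le0 subr_eq0 /= asboolT//= => /eqP/esym.
case: b {vb0} => [u|x y t xy t01] /=.
  by case: (asboolP (u = v)) => [->//|_ /eqP]; rewrite eq_sym oner_eq0.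
by case: ifP => _; last case: ifP => _; move=> ?; exfalso; clear xy; lra.
Qed.

Lemma graph_dist_eq0 a b : graph_dist a b = 0 -> a = b.
Proof.
case: a => [v|x0 y0 t0 xy0 t001]; first exact: graph_distV.
case: b => [v|x y t xy t01].
  by rewrite graph_dist_sym => /graph_distV.
have t001' : 0 < Num.min t0 (1 - t0)
    by rewrite lt_min subr_gt0 andbC; case/andP: (t001) => -> ->.
have tentIL x' y' t' s' : x' <> y' -> 0 <= t' <= 1 -> 0 <= s' <= 1 ->
    `|tentI x0 y0 t0 (edge_point x' y' t') -
      tentI x0 y0 t0 (edge_point x' y' s')| <= `|t' - s'|.
  move=> xy' t01' s01'; rewrite !tentIE//; case: ifP => _.
    set m := Num.min _ _.
    have := ler_dist_dist (t' - t0) (s' - t0).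
    rewrite opprB addrA subrK => dd; apply: le_trans dd.
    have [|] := leP 0 (m - `|t' - t0|); have [|] := leP 0 (m - `|s' - t0|);
      move=> h1 h2; rewrite ?subrr ?normr0//.
    - by rewrite distrC opprB addrC addrA subrK.
    - rewrite subr0 ger0_norm// ler_normr; apply/orP; right; lra.
    - rewrite sub0r normrN ger0_norm// ler_normr; apply/orP; left; lra.
  by rewrite subrr normr0.
move=> ab0; have := graph_dist_lipschitz tentIL
  (Inner x0 y0 t0 xy0 t001) (Inner x y t xy t01).
rewrite ab0 normr_le0 subr_eq0 /= (asboolT (erefl x0)) (asboolT (erefl y0)) /=.
rewrite subrr normr0 subr0.
rewrite (max_r (ltW t001')); set m := Num.min _ _ in t001' *.
case: ifP => [/andP[/asboolP xx0 /asboolP yy0]|_ /eqP mE]; last first.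
  by move: t001'; rewrite mE ltxx.
move=> /eqP mE; have tt0 : t = t0.
  apply/eqP; rewrite -subr_eq0 -normr_le0; move: mE t001'.
  by clear ab0 xy xy0; case: (leP 0 (m - `|t - t0|)) => _ ? ?; lra.
move: tt0 => {m t001' mE tentIL ab0} tt0; subst x0 y0 t0.
by rewrite (Prop_irrelevance xy0 xy) (Prop_irrelevance t001 t01).
Qed.

End graph.

Section cobweb.
Context {R : realType} (X : premetric R).

Definition cobweb_set : set (graph R X) :=
  [set a | exists x y t, [/\ 0 <= t <= 1, t <= 1 - Num.min 1 (pdist y x)
                           & a = edge_point x y t]].

Definition cobweb_dist (a b : cobweb_set) : R := graph_dist (\val a) (\val b).

Fact cobweb_dist_ge0 a b : 0 <= cobweb_dist a b.
Proof. exact: graph_dist_ge0. Qed.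

Fact cobweb_distxx a : cobweb_dist a a = 0.
Proof. exact: graph_distxx. Qed.

Definition cobweb : premetric R := Premetric cobweb_dist_ge0 cobweb_distxx.

Definition compression (a : cobweb) : X :=
  match \val a with Vertex x => x | Inner x _ _ _ _ => x end.

End cobweb.

Section cobweb_omega.
Context {R : realType} (X : premetric R).

(* the iterates are indexed from 0: [iter_cobweb n] is the (n + 1)-st one *)
Fixpoint iter_cobweb (n : nat) : premetric R :=
  if n is n'.+1 then cobweb (iter_cobweb n') else cobweb X.

Definition cobweb_omega : Type :=
  {a : forall n, iter_cobweb n | forall n, compression (a n.+1) = a n}.

(* The supremum is a maximum: the distances in the iterated cobwebs are bounded,
   so that the terms tend to 0. *)
Definition omega_dist (a b : cobweb_omega) : R :=
  sup [set n.+1%:R^-1 * pdist (sval a n) (sval b n) | n in [set: nat]].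

Let iter_cobweb_le3 n (x y : iter_cobweb n) : pdist x y <= 3.
Proof. by case: n x y => [|n] x y; exact: graph_dist_le3. Qed.

Let iter_cobweb_eq0 n (x y : iter_cobweb n) : pdist x y = 0 -> x = y.
Proof.
by case: n x y => [|n] x y /graph_dist_eq0 xy; apply/val_inj.
Qed.

Let iter_cobweb_sym n (x y : iter_cobweb n) : pdist x y = pdist y x.
Proof. by case: n x y => [|n] x y; exact: graph_dist_sym. Qed.

Let iter_cobweb_triangle n (y x z : iter_cobweb n) :
  pdist x z <= pdist x y + pdist y z.
Proof. by case: n x y z => [|n] x y z; exact: graph_dist_triangle. Qed.

Let omega_has_sup (a b : cobweb_omega) :
  has_sup [set (n.+1%:R^-1 : R) * pdist (sval a n) (sval b n)
           | n in [set: nat]].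
Proof.
split; first by exists (1%:R^-1 * pdist (sval a 0%N) (sval b 0%N)), 0%N.
exists 3 => _ [n _ <-]; rewrite -[leRHS]mul1r.
by rewrite ler_pM ?pdist_ge0 ?invr_ge0 ?iter_cobweb_le3// invf_le1 ?ler1n.
Qed.

Let le_omega (a b : cobweb_omega) n :
  n.+1%:R^-1 * pdist (sval a n) (sval b n) <= omega_dist a b.
Proof. by apply: sup_upper_bound; [exact: omega_has_sup|exists n]. Qed.

Let omega_le (a b : cobweb_omega) m :
  (forall n, n.+1%:R^-1 * pdist (sval a n) (sval b n) <= m) ->
  omega_dist a b <= m.
Proof.
move=> mP; apply: sup_le_ub; first by case: (omega_has_sup a b).
by move=> _ [n _ <-].
Qed.

Let omega_distxx a : omega_dist a a = 0.
Proof.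
apply/eqP; rewrite eq_le; apply/andP; split.
  by apply: omega_le => n; rewrite pdistxx mulr0.
by have := le_omega a a 0; rewrite pdistxx mulr0.
Qed.

Let omega_dist_eq0 a b : omega_dist a b = 0 -> a = b.
Proof.
move=> ab0; apply: eq_sig_hprop => [? ? ?|]; first exact: Prop_irrelevance.
apply: functional_extensionality_dep => n.
apply: iter_cobweb_eq0; apply/eqP; rewrite eq_le pdist_ge0 andbT.
by have := le_omega a b n; rewrite ab0 pmulr_rle0// invr_gt0.
Qed.

Let omega_dist_sym a b : omega_dist a b = omega_dist b a.
Proof.
by congr sup; apply/seteqP; split=> _ [n _ <-]; exists n => //;
  rewrite iter_cobweb_sym.
Qed.

Let omega_dist_triangle b a c :
  omega_dist a c <= omega_dist a b + omega_dist b c.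
Proof.
apply: omega_le => n; apply: le_trans (lerD (le_omega a b n) (le_omega b c n)).
by rewrite -mulrDr ler_pM2l ?invr_gt0// iter_cobweb_triangle.
Qed.

HB.instance Definition _ := gen_eqMixin cobweb_omega.
HB.instance Definition _ := gen_choiceMixin cobweb_omega.
HB.instance Definition _ := isMetric.Build R cobweb_omega
  omega_distxx omega_dist_eq0 omega_dist_sym omega_dist_triangle.

Definition compression_omega (a : cobweb_omega) : X :=
  compression (sval a 0%N : cobweb X).

End cobweb_omega.

Section resolution.
Context (R : realType) (X : topologicalType).

Definition resolution : metricType R := cobweb_omega (decomp R X).

Definition resolution_map (a : resolution) : X := calc (compression_omega a).

Definition resolution_map_s (a : resolution) : seq_coreflexion X :=
  resolution_map a.

End resolution.

(* Main.v *)
(* In a cobweb a point that is not a vertex has a neighbourhood on which the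
   compression is constant, and a vertex [v] is approached from another star only
   along spikes [(y, v, t)] with [d(v, y) <= 1 - t].  Hence compressions are
   continuous; conversely, [q] with [d(p, q) <= r] lifts to a point of the cobweb
   within [r] of the vertex [p].  Iterating these lifts, one follows in
   [cobweb_omega M] any small move of a coordinate of a sequence that consists of
   vertices from that coordinate on.
   - Quotient maps: a convergent sequence in [X] is a map on [S_0], which gives
     points of [decomp X] converging to a limit, which lift to the resolution.
   - Connected fibres: if a fibre splits into two clopen pieces, then, stars being
     connected, one finds coordinate by coordinate a sequence all of whose
     coordinates are shared by points of both pieces; it is in the closure of both.
   - Economy: each coordinate of a point of [A] is the compression of the next one,
     and so is determined (in one of two ways) by a point of a dense subset [D] of
     [A]; hence [A] has at most [|nat * D * D| = |D|] distances. *)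
From HB Require Import structures.
Require Import Defs.
From mathcomp Require Import all_boot all_order all_algebra.
From mathcomp Require Import all_classical all_reals all_analysis.
From mathcomp Require Import lra.
Set Implicit Arguments.
Unset Strict Implicit.
Unset Printing Implicit Defensive.
Import Order.TTheory GRing.Theory Num.Theory.
Import numFieldNormedType.Exports.
Local Open Scope classical_set_scope.
Local Open Scope ring_scope.
Local Open Scope card_scope.

(** * Cardinal arithmetic *)

Lemma card_le_fun T U (A : set T) (B : set U) (f : T -> U) :
  set_fun A B f -> set_inj A f -> A #<= B.
Proof.
move=> fAB fI.
have /injfunPex[g] : exists2 g : T -> U, set_fun A B g & set_inj A g by exists f.
exact: inj_card_le.
Qed.

Lemma card_le_funP T U (A : set T) (B : set U) : A #<= B -> B !=set0 ->
  exists2 f : T -> U, set_fun A B f & set_inj A f.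
Proof.
elim/Ppointed: U => U in B *; first by move=> _ [b]; exact: any b.
by move=> /pcard_leP/injfunPex.
Qed.

Lemma subset_image_card_le T U (A : set T) (B : set U) (g : U -> T) :
  A `<=` g @` B -> A #<= B.
Proof. by move=> /subset_card_le /card_le_trans; apply; exact: card_image_le. Qed.

(* A maximal family of choice functions on [P] that pairwise differ everywhere
   exhausts some member of [P], which then injects into all the others. *)
Lemma card_le_minimum T (P : set (set T)) : P !=set0 ->
  exists2 D, P D & forall D', P D' -> D #<= D'.
Proof.
move=> [D0 PD0].
pose Q (S : set (set T -> T)) := (forall s D, S s -> P D -> D (s D)) /\
  (forall s s' D, S s -> S s' -> P D -> s D = s' D -> s = s').
have [F FQ totF|S [[SD Sinj] Smax]] := @Zorn_bigcup _ Q.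
  split; first by move=> s D [S /FQ[SP _] Ss]; exact: SP.
  move=> s s' D [S FS Ss] [S' FS' S's'].
  have [SS'|S'S] := totF _ _ FS FS'.
    by have [_] := FQ _ FS'; apply => //; exact: SS'.
  by have [_] := FQ _ FS; apply => //; exact: S'S.
have [D PD DS] : exists2 D, P D & forall d, D d -> exists2 s, S s & s D = d.
  apply: contrapT => noD.
  have tP D : exists d, P D -> D d /\ forall s, S s -> s D <> d.
    have [PD|nPD] := pselect (P D); last first.
      (* Outside [P] any value will do; one is found in [D0], which [S] does not exhaust by
         [noD]. *)
      have [d _] : exists2 d, D0 d & forall s, S s -> s D0 <> d.
        apply: contrapT => noD'; apply: noD; exists D0 => // d D0d.
        apply: contrapT => nS; apply: noD'; exists d => // s Ss sd.
        by apply: nS; exists s.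
      by exists d.
    apply: contrapT => nd; apply: noD; exists D => // d Dd.
    apply: contrapT => nS; apply: nd; exists d => _; split=> // s Ss sd.
    by apply: nS; exists s.
  have [t tE] := choice tP.
  apply: (Smax (S `|` [set t])).
    split; first exact: subsetUl.
    move=> /(_ t (or_intror erefl)) St.
    by have [_ /(_ _ St)] := tE _ PD0; apply.
  split.
    by move=> s D [Ss|->] PD; [exact: (SD s)|have [] := tE _ PD].
  move=> s s' D [Ss|->] [Ss'|->] // PD; first exact: (Sinj s).
    by have [_ /(_ s Ss)] := tE _ PD.
  by move=> /esym; have [_ /(_ s' Ss')] := tE _ PD.
exists D => // D' PD'.
have [->|/set0P[d0 Dd0]] := eqVneq D set0; first exact: card_ge0.
have [s0 Ss0 _] := DS _ Dd0.
have gP d : exists s, S s /\ (D d -> s D = d).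
  have [/DS[s Ss sd]|nDd] := pselect (D d); first by exists s.
  by exists s0.
have [g gE] := choice gP.
apply: (@card_le_fun _ _ _ _ (fun d => g d D')) => [d Dd|d d' /set_mem Dd /set_mem Dd' gg].
  by apply: (SD (g d)) => //; case: (gE d).
have [Sg /(_ Dd) <-] := gE d; have [Sg' /(_ Dd') <-] := gE d'.
by rewrite (Sinj _ _ _ Sg Sg' PD').
Qed.

(** Both sets are copied into [T + U], so that [card_le_minimum] can compare them as two subsets of
    one type. *)
Lemma card_le_total T U (A : set T) (B : set U) : A #<= B \/ B #<= A.
Proof.
have AE : inl @` A #= A := inj_card_eq (in2W (@inl_inj T U)).
have BE : inr @` B #= B := inj_card_eq (in2W (@inr_inj T U)).
have [|_ [->|->] min] := @card_le_minimum (T + U) [set inl @` A; inr @` B].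
- by exists (inl @` A); left.
- left; rewrite -(card_le_eql AE) -(card_le_eqr BE).
  by apply: min; right.
- right; rewrite -(card_le_eqr AE) -(card_le_eql BE).
  by apply: min; left.
Qed.

Lemma card_leX T T' U U' (A : set T) (A' : set T') (B : set U) (B' : set U') :
  A #<= B -> A' #<= B' -> A `*` A' #<= B `*` B'.
Proof.
move=> AB AB'.
have [A0|/set0P[a Aa]] := eqVneq A set0; first by rewrite A0 set0X.
have [A0|/set0P[a' Aa']] := eqVneq A' set0; first by rewrite A0 setX0.
have [B0|/set0P NB] := eqVneq B set0.
  by move: AB Aa; rewrite B0 => /card_le0P ->.
have [B0|/set0P NB'] := eqVneq B' set0.
  by move: AB' Aa'; rewrite B0 => /card_le0P ->.
have [f fAB fI] := card_le_funP AB NB; have [g gAB gI] := card_le_funP AB' NB'.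
apply: (@card_le_fun _ _ _ _ (fun p => (f p.1, g p.2))).
  by move=> [x y] [/= Ax Ay]; split; [exact: fAB|exact: gAB].
move=> [x y] [x' y'] /set_mem[/= Ax Ay] /set_mem[/= Ax' Ay'] [fx gy].
by rewrite (fI x x') ?inE// (gI y y') ?inE.
Qed.

Lemma infinite_set_seq T (B : set T) : infinite_set B ->
  exists e : nat -> T, (forall n, B (e n)) /\ injective e.
Proof.
move=> Binf; have NB := infinite_setN0 Binf.
move: Binf => /infiniteP /card_le_funP-/(_ NB)[e eB eI].
by exists e; split=> [n|]; [exact: eB|move=> x y; apply: eI; rewrite inE].
Qed.

(** * Squares of infinite sets *)

Section square.
Context {T : Type}.
Implicit Type G : set (T * T * T).

Definition pairing_field G : set T := [set x | exists z, G (x, x, z)].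

(* [G] is the graph of an injection from [B `*` B] into [B], where
   [B := pairing_field G] *)
Definition pairing_graph (D : set T) G :=
  [/\ forall p z z', G (p, z) -> G (p, z') -> z = z',
      forall p p' z, G (p, z) -> G (p', z) -> p = p',
      forall x y z, G (x, y, z) -> [/\ pairing_field G x, pairing_field G y &
        pairing_field G z],
      pairing_field G `<=` D &
      forall x y, pairing_field G x -> pairing_field G y -> exists z, G (x, y, z)].

Lemma pairing_graph_fun D G : pairing_graph D G -> pairing_field G !=set0 ->
  exists g : T -> T -> T, forall x y,
    pairing_field G x -> pairing_field G y -> G (x, y, g x y).
Proof.
move=> [_ _ _ _ tot] [b0 Gb0].
have gP (p : T * T) : exists z, pairing_field G p.1 -> pairing_field G p.2 ->
    G (p, z).
  have [[G1 G2]|nG] := pselect (pairing_field G p.1 /\ pairing_field G p.2).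
    by have [z Gz] := tot _ _ G1 G2; exists z => _ _; case: p Gz {G1 G2}.
  by exists b0 => G1 G2; case: nG.
by have [g gE] := choice gP; exists (fun x y => g (x, y)) => x y Gx Gy; exact: gE.
Qed.

(** Any two triples of the union lie in a common member of the chain, and each clause of
    [pairing_graph] involves at most two triples. *)
Lemma pairing_graph_bigcup D (F : set (set (T * T * T))) :
  F `<=` pairing_graph D -> total_on F subset ->
  pairing_graph D (\bigcup_(G in F) G).
Proof.
move=> FD Ftot.
have two p q : (\bigcup_(G in F) G) p -> (\bigcup_(G in F) G) q ->
    exists2 G, F G & G p /\ G q.
  move=> [G FG Gp] [H FH Hq]; have [GH|HG] := Ftot _ _ FG FH.
    by exists H => //; split=> //; exact: GH.
  by exists G => //; split=> //; exact: HG.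
have sub G : F G -> pairing_field G `<=` pairing_field (\bigcup_(G in F) G).
  by move=> FG x [z Gz]; exists z, G.
split.
- by move=> p z z' /two /[apply] -[G /FD[+ _ _ _ _] []]; apply.
- by move=> p p' z /two /[apply] -[G /FD[_ + _ _ _] []]; apply.
- move=> x y z [G /[dup] FG /FD[_ _ + _ _]] => /[apply] -[? ? ?].
  by split; exact: (sub G).
- by move=> x [z [G /FD[_ _ _ + _] Gz]]; apply; exists z.
- move=> x y [z xz] [z' yz']; have [G FG [Gxz Gyz']] := two _ _ xz yz'.
  have [_ _ _ _ tot] := FD _ FG.
  have [] := tot x y; [by exists z|by exists z'|].
  by move=> w Gw; exists w, G.
Qed.

(** The values on new pairs are placed in a copy [C] of [B] inside [D], disjoint from [B]; the field
    then grows from [B] to the union of [B] and [C]. *)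
Lemma pairing_graph_extend D G : pairing_graph D G ->
  infinite_set (pairing_field G) ->
  pairing_field G #<= D `\` pairing_field G ->
  exists2 G', G `<` G' & pairing_graph D G'.
Proof.
set B := pairing_field G => GD Binf.
have NB := infinite_setN0 Binf; have [g gG] := pairing_graph_fun GD NB.
have [e [eB eI]] := infinite_set_seq Binf.
have [DB0|/set0P NDB] := eqVneq (D `\` B) set0.
  by rewrite DB0 => /card_le0P B0; case: NB => b; rewrite B0.
move=> /card_le_funP-/(_ NDB)[h hB hI].
have [Gf Gi Gc GsD Gt] := GD.
(* [r] is the identity on [B] and folds [C] back onto [B] by inverting [h], so that the old pairing
   [g] can be applied to new pairs. *)
have rP x : exists y, [/\ B x -> y = x, (h @` B) x -> B y /\ h y = x &
    B x \/ (h @` B) x -> B y].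
  have [Bx|nBx] := pselect (B x).
    exists x; split=> //; move=> [b Bb hbx].
    by have [_] := hB _ Bb; rewrite hbx.
  have [[b Bb bx]|nhx] := pselect ((h @` B) x); first by exists b; split.
  by exists x; split=> // -[].
have [r rE] := choice rP.
pose C := h @` B.
have BC x : B x -> C x -> False.
  by move=> Bx [b Bb bx]; have [_] := hB _ Bb; rewrite bx.
(* new pairs are sent into the copy [C] of [B], with a tag telling which of
   [B `*` C], [C `*` B], [C `*` C] they come from *)
pose tag x y : T := e (if `[< B x >] then 0 else if `[< B y >] then 1 else 2)%N.
pose v x y := h (g (tag x y) (g (r x) (r y))).
pose BC2 x := B x \/ C x.
pose N (q : T * T * T) := [/\ BC2 q.1.1, BC2 q.1.2, ~ (B q.1.1 /\ B q.1.2) &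
  q.2 = v q.1.1 q.1.2].
have gB x y : B x -> B y -> B (g x y).
  by move=> Bx By; have [] := Gc _ _ _ (gG _ _ Bx By).
have gI x y x' y' : B x -> B y -> B x' -> B y' -> g x y = g x' y' ->
    x = x' /\ y = y'.
  move=> Bx By Bx' By' gg; have := gG _ _ Bx By; rewrite gg => H.
  by have [-> ->] := Gi _ _ _ H (gG _ _ Bx' By').
have rB x : BC2 x -> B (r x) by move=> ?; have [_ _] := rE x; apply.
have vC x y : BC2 x -> BC2 y -> C (v x y).
  by move=> bx by_; exists (g (tag x y) (g (r x) (r y))) => //;
    apply: (gB); [exact: eB|apply: (gB); exact: rB].
have rI x y : BC2 x -> BC2 y -> `[< B x >] = `[< B y >] -> r x = r y -> x = y.
  move=> bx by_; have [rx1 rx2 _] := rE x; have [ry1 ry2 _] := rE y.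
  case: (asboolP (B x)) => Bx; case: (asboolP (B y)) => By // _.
    by rewrite rx1// ry1.
  case: bx => // /rx2[_ {2}<-]; case: by_ => // /ry2[_ {2}<-].
  by move=> ->.
have vI x y x' y' : N (x, y, v x y) -> N (x', y', v x' y') ->
    v x y = v x' y' -> (x, y) = (x', y').
  move=> [/= bx by_ nB _] [/= bx' by_' nB' _] /hI; rewrite !inE.
  move=> /(_ (gB _ _ (eB _) (gB _ _ (rB _ bx) (rB _ by_)))).
  move=> /(_ (gB _ _ (eB _) (gB _ _ (rB _ bx') (rB _ by_')))).
  move=> /gI[]; [exact: eB|by apply: (gB); exact: rB|exact: eB|by apply: (gB); exact: rB|].
  move=> /eI tt /gI[]; [exact: rB..|] => rxx ryy.
  have [xB yB] : `[< B x >] = `[< B x' >] /\ `[< B y >] = `[< B y' >].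
    move: tt nB nB'; case: (asboolP (B x)); case: (asboolP (B x'));
    case: (asboolP (B y)); case: (asboolP (B y')) => //; tauto.
  by rewrite (rI x x')// (rI y y').
pose G' := G `|` N.
have CD : C `<=` D by move=> _ [b Bb <-]; have [] := hB _ Bb.
have NBC x y : BC2 x -> BC2 y -> ~ (B x /\ B y) -> G' (x, y, v x y).
  by move=> bx by_ nB; right.
have fldE : pairing_field G' = B `|` C.
  apply/seteqP; split=> x.
    by move=> [z [Gz|[]//]]; left; exists z.
  case=> [[z Gz]|Cx]; first by exists z; left.
  exists (v x x); apply: NBC; [by right..|].
  by move=> [Bx _]; exact: BC Bx Cx.
exists G'.
  split; first exact: subsetUl.
  case: NB => b Bb G'G.
  have Ch : C (h b) by exists b.
  have := NBC (h b) (h b) (or_intror Ch) (or_intror Ch).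
  move=> /(_ (fun H => BC _ H.1 Ch)) /G'G Gh.
  by apply: BC Ch; exists (v (h b) (h b)).
rewrite /pairing_graph fldE; split.
- move=> p z z' [Gz|Nz] [Gz'|Nz'].
  + exact: Gf Gz Gz'.
  + case: Nz' => _ _ []; case: p Gz => x y /= Gz.
    by have [] := Gc _ _ _ Gz.
  + case: Nz => _ _ []; case: p Gz' => x y /= Gz.
    by have [] := Gc _ _ _ Gz.
  + by case: Nz => _ _ _ /= ->; case: Nz' => _ _ _ /= ->.
- move=> [x y] [x' y'] z [Gz|Nz] [Gz'|Nz'].
  + exact: Gi Gz Gz'.
  + have [_ _ Bz] := Gc _ _ _ Gz; case: Nz' => /= ? ? _ zE.
    by exfalso; apply: BC Bz _; rewrite zE; exact: vC.
  + have [_ _ Bz] := Gc _ _ _ Gz'; case: Nz => /= ? ? _ zE.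
    by exfalso; apply: BC Bz _; rewrite zE; exact: vC.
  + apply: vI; [by case: Nz|by case: Nz'|].
    by case: Nz => _ _ _ /= <-; case: Nz' => _ _ _ /= <-.
- move=> x y z [/Gc[? ? ?]|[/= bx by_ _ ->]]; first by split; left.
  by split=> //; right; exact: vC.
- by move=> x [/GsD//|/CD].
- move=> x y bx by_; have [[Bx By]|nB] := pselect (B x /\ B y).
    by have [z Gz] := Gt _ _ Bx By; exists z; left.
  by exists (v x y); exact: NBC.
Qed.

End square.

(* By Zorn there is a maximal graph of an injection [B `*` B -> B] with [B] an
   infinite subset of [D]; it could be extended if [D `\` B] were as large as [B]. *)
Lemma infinite_card_square T (D : set T) : infinite_set D -> D `*` D #<= D.
Proof.
move=> Dinf; have [e [eD eI]] := infinite_set_seq Dinf.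
pose G0 : set (T * T * T) := [set q | exists m n,
  q = (e m, e n, e (pickle (m, n)))].
have fld0 : pairing_field G0 = range e.
  apply/seteqP; split=> x; first by move=> [z [m [n [-> _ _]]]]; exists m.
  by move=> [n _ <-]; exists (e (pickle (n, n))), n, n.
have G0D : pairing_graph D G0.
  rewrite /pairing_graph fld0; split.
  - by move=> p z z' [m [n [-> ->]]] [m' [n' [/eI -> /eI -> ->]]].
  - move=> p p' z [m [n [-> ->]]] [m' [n' [-> /eI]]].
    by move=> /(pcan_inj pickleK)[-> ->].
  - by move=> x y z [m [n [-> -> ->]]]; split; [exists m|exists n|eexists].
  - by move=> _ [n _ <-].
  - by move=> _ _ [m _ <-] [n _ <-]; exists (e (pickle (m, n))), m, n.
pose P (G : set (T * T * T)) := G = set0 \/ (G0 `<=` G /\ pairing_graph D G).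
have [F FP Ftot|G [PG Gmax]] := @Zorn_bigcup _ P.
  have [FN0|nF] := pselect (exists2 G, F G & G <> set0); last first.
    left; apply/seteqP; split=> // q [G FG Gq].
    by apply: nF; exists G => // G0'; rewrite G0' in Gq.
  right; split.
    have [G FG GN0] := FN0; apply: subset_trans (bigcup_sup FG).
    by have [] := FP _ FG => // -[].
  pose F' := F `&` [set G | G <> set0].
  have -> : \bigcup_(G in F) G = \bigcup_(G in F') G.
    apply/seteqP; split=> q [G]; last by move=> [? ?] ?; exists G.
    by move=> FG' Gq; exists G => //; split=> // G0'; rewrite G0' in Gq.
  apply: pairing_graph_bigcup => [G [FG' GN0]|G H [? _] [? _]]; last exact: Ftot.
  by case: (FP _ FG') => [/GN0|[]].
have [G0G GD] : G0 `<=` G /\ pairing_graph D G.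
  case: PG => // GE; exfalso; apply: (Gmax G0); last by right; split.
  rewrite GE; split=> // /(_ (e 0%N, e 0%N, e (pickle (0%N, 0%N)))) H.
  by apply: H; exists 0%N, 0%N.
pose B := pairing_field G.
have Binf : infinite_set B.
  apply/infiniteP; apply: (@card_le_fun _ _ _ _ e) => [n _|m n _ _ /eI//].
  by exists (e (pickle (n, n))); apply: G0G; exists n, n.
have [Gf Gi Gc BD Gt] := GD.
have BB : B `*` B #<= B.
  have [g gG] := pairing_graph_fun GD (infinite_setN0 Binf).
  apply: (@card_le_fun _ _ _ _ (fun p => g p.1 p.2)).
    by move=> [x y] [/= Bx By]; have [] := Gc _ _ _ (gG _ _ Bx By).
  move=> [x y] [x' y'] /set_mem[/= Bx By] /set_mem[/= Bx' By'] gg.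
  by have := gG _ _ Bx By; rewrite gg => H; exact: Gi H (gG _ _ Bx' By').
have [DB|BDB] := card_le_total (D `\` B) B; last first.
  have [G' GG' G'D] := pairing_graph_extend GD Binf BDB.
  exfalso; apply: (Gmax _ GG'); right; split=> //.
  by case: GG' => GG' _; exact: subset_trans GG'.
(* [D] splits into [B] and a set no larger than [B]; the distinct tags [b 0] and [b 1] keep the two
   apart inside the square of [B]. *)
have DleB : D #<= B.
  apply: card_le_trans BB.
  have [f fB fI] := card_le_funP DB (infinite_setN0 Binf).
  have [b [bB bI]] := infinite_set_seq Binf.
  apply: (@card_le_fun _ _ _ _ (fun x =>
    if `[< B x >] then (b 0%N, x) else (b 1%N, f x))).
    by move=> x Dx; case: asboolP => Bx; split;
      [exact: (bB 0%N)| |exact: (bB 1%N)|apply: fB; split].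
  move=> x y /set_mem Dx /set_mem Dy.
  case: asboolP => Bx; case: asboolP => By [].
  - by [].
  - by move=> /bI.
  - by move=> /bI.
  - by apply: fI; rewrite inE; split.
by apply: card_le_trans (card_leX DleB DleB) (card_le_trans BB (subset_card_le BD)).
Qed.

(** This serves to count distances that are named by a countable label and two points of a dense
    subset. *)
Lemma countable_infinite_card_leX (I : countType) T (D : set T) : infinite_set D ->
  [set: I] `*` (D `*` D) #<= D.
Proof.
move=> Dinf; have DD := infinite_card_square Dinf.
apply: card_le_trans DD; apply: card_leX; last exact: infinite_card_square.
have /infiniteP := Dinf; apply: card_le_trans.
exact: countableP.
Qed.

(** * Cardinality of the resolution *)

Definition embeds (T U : Type) := exists f : T -> U, injective f.

Lemma embeds_trans T U V : embeds T U -> embeds U V -> embeds T V.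
Proof. by move=> [f fI] [g gI]; exists (g \o f); exact: inj_comp. Qed.

Lemma embeds_fun (I T U : Type) : embeds T U -> embeds (I -> T) (I -> U).
Proof.
move=> [f fI]; exists (fun a => f \o a) => a b /funeqP ab.
by apply/funext => i; exact/fI/ab.
Qed.

Lemma embeds_prod T T' U U' : embeds T U -> embeds T' U' -> embeds (T * T') (U * U').
Proof.
move=> [f fI] [g gI]; exists (fun p => (f p.1, g p.2)).
by move=> [x y] [x' y'] [/fI -> /gI ->].
Qed.

Lemma embeds_seq_pair T : embeds (T * T) (nat -> T).
Proof.
exists (fun p n => if n is 0 then p.1 else p.2) => -[x y] [x' y'] /funeqP pq.
by have /= -> := pq 0%N; have /= -> := pq 1%N.
Qed.

(** * Countable powers of the reals *)

Section embed_in_reals.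
Context (R : realType).
Implicit Types f : nat -> bool.

(** The first [n] terms of the series of [f k / 3 ^ k], in Horner form. In base 3, unlike base 2,
    distinct bit sequences have distinct sums. *)
Fixpoint ternary_sum n f : R :=
  if n is n'.+1 then (f 0%N)%:R + ternary_sum n' (f \o succn) / 3 else 0.

Definition ternary f : R := sup [set ternary_sum n f | n in [set: nat]].

Lemma ternary_sum_itv n f : 0 <= ternary_sum n f <= 3 / 2.
Proof.
elim: n f => [|n IH] f /=; first lra.
by have := IH (f \o succn); case: (f 0%N) => /=; lra.
Qed.

Lemma ternary_has_sup f : has_sup [set ternary_sum n f | n in [set: nat]].
Proof.
split; first by exists 0, 0%N.
by exists (3 / 2) => _ [n _ <-]; have /andP[] := ternary_sum_itv n f.
Qed.

Lemma ternary_ge n f : ternary_sum n f <= ternary f.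
Proof. by apply: sup_upper_bound; [exact: ternary_has_sup|exists n]. Qed.

Lemma ternary_le m f : (forall n, ternary_sum n f <= m) -> ternary f <= m.
Proof.
move=> fm; apply: sup_le_ub; first by case: (ternary_has_sup f).
by move=> _ [n _ <-].
Qed.

Lemma ternary_rec f : ternary f = (f 0%N)%:R + ternary (f \o succn) / 3.
Proof.
apply/eqP; rewrite eq_le; apply/andP; split.
  apply: ternary_le => -[|n] /=.
    by have /= := ternary_ge 0 (f \o succn); case: (f 0%N) => /=; lra.
  by have := ternary_ge n (f \o succn); lra.
suff : ternary (f \o succn) <= 3 * (ternary f - (f 0%N)%:R) by lra.
by apply: ternary_le => n; have /= := ternary_ge n.+1 f; lra.
Qed.

Lemma ternary_itv f : 0 <= ternary f <= 3 / 2.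
Proof.
apply/andP; split; first exact: (ternary_ge 0 f).
by apply: ternary_le => n; have /andP[] := ternary_sum_itv n f.
Qed.

(** A leading bit 1 contributes 1, whereas everything after a leading bit 0 contributes at most 1/2.
    Hence the leading bits agree, and then so do the tails. *)
Lemma ternary_inj : injective ternary.
Proof.
move=> f f' ff'; apply/funext => n; elim: n f f' ff' => [|n IH] f f' ff'.
  have := ternary_itv (f \o succn); have := ternary_itv (f' \o succn).
  move: ff'; rewrite (ternary_rec f) (ternary_rec f').
  by case: (f 0%N); case: (f' 0%N) => //=; lra.
suff ff'0 : f 0%N = f' 0%N.
  apply: (IH (f \o succn) (f' \o succn)).
  by move: ff'; rewrite (ternary_rec f) (ternary_rec f') ff'0; lra.
have := ternary_itv (f \o succn); have := ternary_itv (f' \o succn).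
move: ff'; rewrite (ternary_rec f) (ternary_rec f').
by case: (f 0%N); case: (f' 0%N) => //=; lra.
Qed.

(** A real number is coded by its lower Dedekind cut in the enumerated rationals. *)
Lemma embeds_real_bitseq : embeds R (nat -> bool).
Proof.
exists (fun x n => if unpickle n is Some q then ratr q < x else false) => x y.
move=> /funeqP xy.
have ltE q : (ratr q < x) = (ratr q < y) by have := xy (pickle q); rewrite pickleK.
apply/eqP; rewrite eq_le !leNgt; apply/andP; split; apply/negP => lt.
  have [q] := rat_in_itvoo lt; rewrite in_itv/= => /andP[yq qx].
  by move: qx; rewrite ltE ltNge (ltW yq).
have [q] := rat_in_itvoo lt; rewrite in_itv/= => /andP[yq qx].
by move: qx; rewrite -ltE ltNge (ltW yq).
Qed.

Lemma embeds_seq_seq T : embeds (nat -> nat -> T) (nat -> T).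
Proof.
have [[x _]|noT] := pselect (exists x : T, True); last first.
  by exists (fun a => a 0%N) => a; case: noT; exists (a 0%N 0%N).
exists (fun a n => if unpickle n is Some (i, j) then a i j else x) => a b /funeqP ab.
apply/funext => i; apply/funext => j.
by have /= := ab (pickle (i, j)); rewrite pickleK.
Qed.

Lemma embeds_seq_real : embeds (nat -> R) R.
Proof.
apply: embeds_trans (embeds_fun nat embeds_real_bitseq) _.
apply: embeds_trans (embeds_seq_seq bool) _.
by exists ternary; exact: ternary_inj.
Qed.

(** [R * (nat -> X)] stands for the cardinal bound of the theorem. That it absorbs its own countable
    powers is what the passage to sequences of coordinates requires. *)
Lemma embeds_seq_real_seq X : embeds (nat -> R * (nat -> X)) (R * (nat -> X)).
Proof.
apply: (@embeds_trans _ ((nat -> R) * (nat -> nat -> X))); last first.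
  exact: embeds_prod embeds_seq_real (embeds_seq_seq X).
exists (fun a => (fst \o a, snd \o a)) => a b [/funeqP ab1 /funeqP ab2].
by apply/funext => n; have /= := ab1 n; have /= := ab2 n; case: (a n) (b n) => ? ? [? ?] /= -> ->.
Qed.

End embed_in_reals.

(** Inner points have distinct ends, so the diagonal is free to code the vertices. *)
Lemma embeds_graph (R : realType) M : embeds (graph R M) (R * (M * M)).
Proof.
exists (fun a => match a with Vertex x => (0, (x, x))
                            | Inner x y t _ _ => (t, (x, y)) end).
case=> [x|x y t xy t01] [x'|x' y' t' xy' t01'] //=.
- by move=> [->].
- by move=> [_ xx' xy]; case: xy'; rewrite -xx' -xy.
- by move=> [_ xx' yx']; case: xy; rewrite xx' yx'.
- move=> [tt' xx' yy']; subst x' y' t'.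
  by rewrite (Prop_irrelevance xy' xy) (Prop_irrelevance t01' t01).
Qed.

Lemma embeds_iter_cobweb (R : realType) (M : premetric R) T :
  embeds R T -> embeds (T * (T * T)) T -> embeds M T ->
  forall n, embeds (iter_cobweb M n) T.
Proof.
move=> RT TT MT.
have graphT N : embeds N T -> embeds (graph R N) T.
  move=> NT; apply: embeds_trans (embeds_graph R N) _.
  by apply: embeds_trans (TT); do 2 ?apply: embeds_prod.
have valT (N : premetric R) : embeds (graph R N) T -> embeds (cobweb N) T.
  by apply: embeds_trans; exists \val; exact: val_inj.
by elim=> [|n IH]; exact/valT/graphT.
Qed.

Lemma embeds_cobweb_omega (R : realType) (M : premetric R) T :
  embeds R T -> embeds (nat -> T) T -> embeds M T -> embeds (cobweb_omega M) T.
Proof.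
move=> RT TT MT; apply: embeds_trans (TT).
have TTT : embeds (T * T) T by apply: embeds_trans (embeds_seq_pair T) (TT).
have TTTT : embeds (T * (T * T)) T.
  by apply: embeds_trans (TTT); apply: embeds_prod => //; exists id.
have H := embeds_iter_cobweb RT TTTT MT.
pose e n := projT1 (cid (H n)); have eI n : injective (e n) := projT2 (cid (H n)).
exists (fun a n => e n (sval a n)) => a b /funeqP ab.
apply: eq_sig_hprop => [? ? ?|]; first exact: Prop_irrelevance.
by apply: functional_extensionality_dep => n; exact/eI/ab.
Qed.

Lemma S0_0_subproof (R : realType) : 0 \in S0 R.
Proof. by rewrite inE; left. Qed.
Definition S0_0 (R : realType) : S0 R := exist _ 0 (S0_0_subproof R).
Lemma S0_inv_subproof (R : realType) n : n.+1%:R^-1 \in S0 R.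
Proof. by rewrite inE; right; exists n. Qed.
Definition S0_inv (R : realType) n : S0 R := exist _ n.+1%:R^-1 (S0_inv_subproof R n).

Lemma S0P (R : realType) (t : S0 R) : t = S0_0 R \/ exists n, t = S0_inv R n.
Proof.
have := set_valP t => -[t0|[n _ tn]]; first by left; exact/val_inj.
by right; exists n; apply/val_inj.
Qed.

Lemma embeds_decomp (R : realType) (X : topologicalType) :
  embeds (decomp R X) (R * (nat -> X)).
Proof.
(* Entry 0 of the sequence is the value at the limit point 0, and entry [n] with [0 < n] is the
   value at [1 / n]. *)
exists (fun p : decomp R X => (\val p.2, fun n => p.1 (if n is n'.+1 then S0_inv R n' else S0_0 R))).
move=> [f t] [g s] E; have /funeqP /= fg := congr1 snd E.
have -> : t = s by apply/val_inj; exact: (congr1 fst E).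
congr pair; apply/continuousEP.
move=> u; have [->|[n ->]] := S0P u; first exact: (fg 0%N).
exact: (fg n.+1).
Qed.

Lemma card_resolution (R : realType) (X : topologicalType) :
  [set: resolution R X] #<= [set: R * (nat -> X)].
Proof.
(* A point of [X] is needed to embed [R] into [R * (nat -> X)]; if there is none, the resolution is
   empty as well. *)
have [[x _]|noX] := pselect (exists x : X, True); last first.
  apply: (@card_le_fun _ _ _ _ (fun a => (0, fun=> resolution_map a))) => // a.
  by case: noX; exists (resolution_map a).
have [f fI] : embeds (resolution R X) (R * (nat -> X)).
  apply: embeds_cobweb_omega (embeds_decomp R X).
    by exists (fun r => (r, fun=> x)) => r s [].
  exact: embeds_seq_real_seq.
by apply: (@card_le_fun _ _ _ _ f) => // a b _ _ /fI.
Qed.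

(** * The metric of the graph and of the cobweb *)

Section graph_metric.
Context {R : realType} {X : Type}.
Implicit Types (a b : graph R X) (x y v : X) (t s : R).

(** This is the distance to the set of vertices: [graph_dist_nearest] and [height_lipschitz] give
    the two inequalities. *)
Definition height a : R :=
  if a is Inner _ _ t _ _ then Num.min t (1 - t) else 0.

Definition nearest a : X :=
  match a with Vertex x => x | Inner x y t _ _ => if t <= 1 / 2 then x else y end.

Lemma graph_dist_edge x y t s : x <> y -> 0 <= t <= 1 -> 0 <= s <= 1 ->
  graph_dist (edge_point x y t) (edge_point x y s) <= `|t - s|.
Proof. by move=> xy t01 s01; apply/graph_dist_le/chain1; constructor. Qed.

Lemma graph_dist_nearest a : graph_dist (Vertex (nearest a)) a <= height a.
Proof.
case: a => [x|x y t xy t01] /=; first by rewrite graph_distxx.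
have t01' : 0 <= t <= 1 by move: t01 => /andP[? ?]; rewrite !ltW.
rewrite -(edge_point_inner xy t01); case: ifP => t2.
  rewrite -(edge_point0 x y); apply: le_trans (graph_dist_edge _ _ _) _ => //.
    by rewrite lexx ler01.
  by rewrite sub0r normrN ger0_norm ?(andP t01').1// le_min; lra.
rewrite -(edge_point1 x y); apply: le_trans (graph_dist_edge _ _ _) _ => //.
  by rewrite lexx ler01.
by rewrite ger0_norm ?subr_ge0 ?(andP t01').2// le_min; lra.
Qed.

Lemma heightE x y t : x <> y -> 0 <= t <= 1 ->
  height (edge_point x y t) = Num.min t (1 - t).
Proof.
move=> xy /(edge_pointP xy)[[-> ->]|[-> ->]|[? [? ->]]] //=.
  by rewrite subr0 min_l.
by rewrite subrr min_r.
Qed.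

Lemma height_lipschitz a b : `|height a - height b| <= graph_dist a b.
Proof.
apply: graph_dist_lipschitz => x y t s xy t01 s01; rewrite !heightE//.
have := ler_norm (t - s); have := ler_norm (s - t); rewrite (distrC s t) ler_norml.
by have [|] := leP t (1 - t); have [|] := leP s (1 - s); lra.
Qed.

Lemma graph_dist_vertices x y : x <> y -> 1 <= graph_dist (Vertex x) (Vertex y) :> R.
Proof.
move=> xy.
(* A tent with value 1 at [x] and 0 at all other vertices; it is 1-Lipschitz on every edge, hence
   for [graph_dist]. *)
pose phi (a : graph R X) : R := match a with
  | Vertex u => (`[< u = x >])%:R
  | Inner u w t _ _ => if `[< u = x >] then 1 - t
                       else if `[< w = x >] then t else 0 end.
have phiE u w t : u <> w -> 0 <= t <= 1 -> phi (edge_point u w t) =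
    if `[< u = x >] then 1 - t else if `[< w = x >] then t else 0.
  move=> uw /(edge_pointP uw)[[-> ->]|[-> ->]|[? [? ->]]] //=.
    by rewrite subr0 if_same; case: asboolP.
  rewrite subrr; case: (asboolP (u = x)) => [ux|_]; last by case: asboolP.
  by case: asboolP => // wx; case: uw; rewrite ux.
have := @graph_dist_lipschitz R X phi _ (Vertex x) (Vertex y).
rewrite /= asboolT// asboolF ?subr0 ?normr1; last exact: nesym.
apply=> u w t s uw t01 s01; rewrite !phiE//.
case: ifP => _; last by case: ifP => _; rewrite ?subrr ?normr0.
by rewrite opprB addrC subrKA distrC.
Qed.

Variant near_vertex_spec v (d : R) : graph R X -> Prop :=
| NearVertex : near_vertex_spec v d (Vertex v)
| NearSource y t xy t01 of t <= d : near_vertex_spec v d (Inner v y t xy t01)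
| NearTarget y t xy t01 of 1 - t <= d : near_vertex_spec v d (Inner y v t xy t01).

(** Another nearest vertex would lie within [height b + d <= 2 * d < 1] of [v], but distinct
    vertices are at distance at least 1. *)
Lemma nearest_near v b : graph_dist (Vertex v) b < 1 / 2 -> nearest b = v.
Proof.
set d := graph_dist _ _ => d1; apply: contrapT => nv.
have := height_lipschitz (Vertex v) b; rewrite -/d /= sub0r normrN => h.
have := le_trans (graph_dist_vertices (nesym nv)) (graph_dist_triangle b _ _).
rewrite -/d (graph_dist_sym b).
have := graph_dist_nearest b; have := ler_norm (height b); lra.
Qed.

Lemma near_vertexP v b : graph_dist (Vertex v) b < 1 / 2 ->
  near_vertex_spec v (graph_dist (Vertex v) b) b.
Proof.
move=> d1; have := nearest_near d1.
have := height_lipschitz (Vertex v) b; rewrite /= sub0r normrN => h.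
have {h} := le_trans (ler_norm _) h.
case: b d1 => [x|x y t xy t01] /= d1 h; first by move=> ->; constructor.
case: ifP => t2 E; subst v; constructor; move: h; rewrite ge_min => /orP[]; lra.
Qed.

Lemma near_innerP x y t (xy : x <> y) (t01 : 0 < t < 1) b :
  graph_dist (Inner x y t xy t01) b < Num.min t (1 - t) ->
  exists s s01, b = Inner x y s xy s01 /\
    `|t - s| <= graph_dist (Inner x y t xy t01) b.
Proof.
set a := Inner _ _ _ _ _; set m := Num.min t _.
(* a tent of height [m] around [a] on the edge from [x] to [y] *)
pose phi (a : graph R X) : R := if a is Inner u w s _ _ then
  if `[< u = x /\ w = y >] then Num.max 0 (m - `|t - s|) else 0 else 0.
have m0 : 0 < m by rewrite lt_min; lra.
have phiE u w s : u <> w -> 0 <= s <= 1 -> phi (edge_point u w s) =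
    if `[< u = x /\ w = y >] then Num.max 0 (m - `|t - s|) else 0.
  move=> uw /(edge_pointP uw)[[-> ->]|[-> ->]|[? [? ->]]] //=;
    case: ifP => // _; rewrite max_l// subr_le0.
    by rewrite subr0 ger0_norm; [rewrite ge_min lexx|lra].
  by rewrite ler0_norm; [rewrite opprB ge_min lexx orbT|lra].
have phiL : `|phi a - phi b| <= graph_dist a b.
  apply: graph_dist_lipschitz => u w s s' uw s01 s'01; rewrite !phiE//.
  case: ifP => _; last by rewrite subrr normr0.
  have := ler_distD s' t s; have := ler_distD s t s'; rewrite (distrC s' s).
  move: `|t - s| `|t - s'| => p q ? ?; rewrite ler_norml.
  by have [|] := leP 0 (m - p); have [|] := leP 0 (m - q); lra.
move: phiL; rewrite {1}/phi /= asboolT// subrr normr0 subr0 (max_r (ltW m0)).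
case: b => [v|u w s uw s01] /= + dm.
  by rewrite subr0 gtr0_norm// leNgt dm.
case: asboolP => [[ux wy]|_]; last by rewrite subr0 gtr0_norm// leNgt dm.
move: uw dm; rewrite ux wy => uw dm h.
rewrite (Prop_irrelevance uw xy) in dm h *; exists s, s01; split=> //.
move: h; rewrite ler_norml; have [|] := leP 0 (m - `|t - s|); lra.
Qed.

End graph_metric.

(** * Cobwebs: lifts, compressions, completeness and stars *)

Section cobweb_geometry.
Context {R : realType} {X : premetric R}.
Implicit Types (a b : cobweb X) (x y p q : X) (r t s : R).

Lemma cobweb_setI x y t : 0 <= t <= 1 -> t <= 1 - Num.min 1 (pdist y x) ->
  edge_point x y t \in @cobweb_set R X.
Proof. by move=> t01 td; rewrite inE; exists x, y, t. Qed.

Lemma cobweb_set_vertex p : Vertex p \in @cobweb_set R X.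
Proof.
have := @cobweb_setI p p 0; rewrite edge_point0; apply; first by rewrite lexx ler01.
by rewrite subr_ge0 ge_min lexx.
Qed.

Definition cobweb_pt (a : graph R X) (h : a \in @cobweb_set R X) : cobweb X :=
  exist _ a h.

Definition cobweb_vertex p : cobweb X := exist _ (Vertex p) (cobweb_set_vertex p).

Lemma cobweb_set_inner x y t xy t01 :
  @cobweb_set R X (Inner x y t xy t01) -> t <= 1 - Num.min 1 (pdist y x).
Proof.
move=> [x' [y' [t' [t'01 t'd]]]]; have [<-|xy'] := pselect (x' = y').
  by rewrite /edge_point; case: pselect.
have [[_ ->]|[_ ->]|[? [? ->]]] := edge_pointP xy' t'01; [by []|by []|].
by move=> [-> -> ->].
Qed.

Lemma compression_edge_point x y t (h : edge_point x y t \in @cobweb_set R X) :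
  t < 1 -> compression (cobweb_pt h) = x.
Proof.
move=> t1; rewrite /compression /=; rewrite /edge_point; case: pselect => // xy.
case: {-}_ / idP => // nt; rewrite ifT//.
by rewrite leNgt; apply/negP => t0; apply: nt; rewrite t0.
Qed.

(** For [q <> p] the witness is the point at distance [r] from [p] on the spike from [q] towards
    [p]. It belongs to the cobweb because [pdist p q <= r], and [0 < r] keeps it away from the
    vertex [p], which would compress to [p]. *)
Lemma compression_lift p q r : 0 < r -> r <= 1 -> pdist p q <= r ->
  exists2 b, compression b = q & pdist (cobweb_vertex p) b <= r.
Proof.
move=> r0 r1 pqr.
have h : edge_point q p (1 - r) \in @cobweb_set R X.
  apply: cobweb_setI; first lra.
  by rewrite lerD2l lerN2 ge_min pqr orbT.
exists (cobweb_pt h); first by apply: compression_edge_point; lra.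
rewrite /= /cobweb_dist /=; have [qp|qp] := pselect (q = p).
  by rewrite /edge_point; case: pselect => // _; rewrite qp graph_distxx ltW.
rewrite -(edge_point1 q p).
apply: le_trans (graph_dist_edge qp _ _) _; [lra..|].
by rewrite opprB addrC subrK ger0_norm// ltW.
Qed.

(** The second alternative occurs only when [a] is a vertex and [b] lies on a spike of another star.
    Its clause on [nearest] lets the economy argument recover [compression a] from [b]; its
    inequality gives continuity. *)
Lemma compression_near a : exists2 d : R, 0 < d & forall b, pdist a b < d ->
  compression b = compression a \/
  (compression a = nearest (\val b) /\
   pdist (compression a) (compression b) <= pdist a b).
Proof.
case: a => -[v|x y t xy t01] ain.
  exists (1 / 2); first lra.
  move=> -[b bin] ab; rewrite /compression /=.
  have /= E := nearest_near ab; rewrite /= /cobweb_dist /= in ab *.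
  move: (near_vertexP ab) E bin; set d := graph_dist (Vertex v) b; move: d => d.
  case=> /=; [by left|by left|].
  move=> y t yv t01 td; case: ifP => // t2 _ bin; right; split=> //.
  (* As [0 < t], the minimum with 1 in the definition of the cobweb must be [pdist v y] itself. *)
  have tc := cobweb_set_inner (set_mem bin); apply: le_trans _ td.
  by move: tc (t01); have [|] := leP 1 (pdist v y); lra.
exists (Num.min t (1 - t)); first by rewrite lt_min; lra.
move=> -[b bin] ab; left; rewrite /compression /=.
by have /= [s [s01 [-> _]]] := near_innerP ab.
Qed.

Section cobweb_cauchy.
Context (u : nat -> cobweb X)
  (uc : forall e : R, 0 < e -> exists N, forall i j, (N <= i)%N ->
    (N <= j)%N -> pdist (u i) (u j) < e).

Let cobweb_cauchy_vertex :
  (forall e : R, 0 < e -> forall N, exists2 i, (N <= i)%N & height (\val (u i)) < e) ->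
  exists l, forall e : R, 0 < e -> exists N, forall i, (N <= i)%N -> pdist l (u i) < e.
Proof.
move=> low.
have [|N NP] := uc (e := 1 / 4); first lra.
have [|i0 Ni0 hi0] := low (1 / 4) _ N; first lra.
pose v := nearest (\val (u i0)); exists (cobweb_vertex v) => e e0.
have [|N' N'P] := uc (e := Num.min (1 / 4) (e / 2)); first by rewrite lt_min; lra.
have [|i1 Ni1 hi1] := low (Num.min (1 / 4) (e / 2)) _ (maxn N N').
  by rewrite lt_min; lra.
exists N' => i N'i; rewrite lt_min in hi1; rewrite geq_max in Ni1.
(* Both points are within 1/4 of their nearest vertices and of each other, so these vertices are at
   distance less than 3/4 and coincide. *)
have E : nearest (\val (u i1)) = v.
  apply: contrapT => nv.
  have := graph_dist_vertices (R := R) nv.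
  have := graph_dist_triangle (\val (u i1)) (Vertex (nearest (\val (u i1)))) (Vertex v).
  have := graph_dist_triangle (\val (u i0)) (\val (u i1)) (Vertex v).
  have := graph_dist_nearest (\val (u i0)); have := graph_dist_nearest (\val (u i1)).
  rewrite -/v (graph_dist_sym (Vertex v)).
  by have := NP i1 i0 (andP Ni1).1 Ni0; rewrite /= /cobweb_dist; lra.
have := N'P i1 i (andP Ni1).2 N'i; rewrite /= /cobweb_dist /= -E lt_min.
have := graph_dist_nearest (\val (u i1)).
have := graph_dist_triangle (\val (u i1)) (Vertex (nearest (\val (u i1)))) (\val (u i)).
lra.
Qed.

Let cobweb_cauchy_edge (e : R) (N : nat) :
  0 < e -> (forall i, (N <= i)%N -> e <= height (\val (u i))) ->
  exists l, forall e : R, 0 < e -> exists N, forall i, (N <= i)%N -> pdist l (u i) < e.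
Proof.
move=> e0 high; have [N1 N1P] := uc e0.
pose N2 := maxn N N1.
have N2P i j : (N2 <= i)%N -> (N2 <= j)%N -> pdist (u i) (u j) < height (\val (u i)).
  rewrite !geq_max => /andP[? ?] /andP[? ?].
  by apply: lt_le_trans (high _ _) => //; exact: N1P.
have := high N2 (leq_maxl _ _).
case uE : (\val (u N2)) => [v|x y t0 xy t01] /=; first by rewrite leNgt e0.
move=> _.
pose c i : R := if \val (u i) is Inner _ _ s _ _ then s else 0.
have cP i : (N2 <= i)%N -> exists c01, \val (u i) = Inner x y (c i) xy c01.
  move=> N2i; have H := N2P N2 i (leqnn _) N2i; rewrite uE /= /cobweb_dist uE in H.
  by have [s [s01 [E _]]] := near_innerP H; rewrite /c E; exists s01.
have cc i j : (N2 <= i)%N -> (N2 <= j)%N -> `|c i - c j| <= pdist (u i) (u j).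
  move=> N2i N2j; have H := N2P i j N2i N2j; rewrite /= /cobweb_dist.
  have [ci uiE] := cP i N2i; have [cj ujE] := cP j N2j.
  rewrite uiE /= /cobweb_dist uiE ujE in H; rewrite uiE ujE.
  by have [s [s01 [E le]]] := near_innerP H; have cs : c j = s by [case: E]; rewrite -cs in le.
have ch i : (N2 <= i)%N -> e <= c i <= 1 - e.
  move=> N2i; have := high i; have [ci -> /=] := cP i N2i.
  by move=> /(_ (leq_trans (leq_maxl _ _) N2i)); rewrite le_min; lra.
have /cauchy_cvgP/cvg_ex[t /= ct] : cauchy ((fun i => c (i + N2)%N) @ \oo).
  apply/cauchy_ballP => d d0; have [M MP] := uc d0.
  exists ([set c (i + N2)%N | i in [set i | (M <= i)%N]],
          [set c (i + N2)%N | i in [set i | (M <= i)%N]]) => /=.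
    by split; exists M => // i /= Mi; exists i.
  move=> [_ _] /= [[i Mi <-] [j Mj <-]]; rewrite /ball /=.
  apply: le_lt_trans (cc _ _ (leq_addl _ _) (leq_addl _ _)) _.
  by apply: MP; exact: leq_trans (leq_addr _ _).
have tP d : 0 < d -> exists M, forall i, (M <= i)%N -> (N2 <= i)%N /\ `|t - c i| < d.
  move=> d0; have [M _ MP] := (cvgrPdist_lt _ _).1 ct d d0.
  exists (M + N2)%N => i Mi; have N2i := leq_trans (leq_addl M N2) Mi; split=> //.
  by have := MP (i - N2)%N; rewrite /= subnK//; apply; rewrite /= leq_subRL// addnC.
(* Closed inequalities pass to the limit: the choice [f = id] yields upper bounds on [t], and
   [f = -%R] lower bounds. *)
have closed_le (m : R) (f : R -> R) : (f = id \/ f = -%R) ->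
    (forall i, (N2 <= i)%N -> f (c i) <= m) -> f t <= m.
  move=> fE cm; rewrite leNgt; apply/negP => mt.
  have [|M MP] := tP (f t - m); first by rewrite subr_gt0.
  have [N2M] := MP M (leqnn _); have := cm M N2M.
  by rewrite ltr_norml; case: fE mt => ->; lra.
have t01' : 0 < t < 1.
  have te : t <= 1 - e.
    by apply: (closed_le _ id); [left|move=> i /ch; lra].
  have et : - t <= - e.
    by apply: (closed_le _ -%R); [right|move=> i /ch; lra].
  by move: te et e0; lra.
have tin : Inner x y t xy t01' \in @cobweb_set R X.
  rewrite -edge_point_inner; apply: cobweb_setI; first by move: t01'; lra.
  apply: (closed_le _ id); [by left|move=> i /cP[ci uiE]].
  by apply: (@cobweb_set_inner _ _ _ xy ci); rewrite -uiE; exact: set_valP.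
exists (cobweb_pt tin) => d d0; have [M MP] := tP _ d0; exists M => i /MP[N2i].
apply: le_lt_trans; rewrite /= /cobweb_dist; have [ci ->] := cP _ N2i.
rewrite /= -!edge_point_inner; apply: graph_dist_edge => //.
  by move: (t01'); lra.
by move: ci; lra.
Qed.

(* A Cauchy sequence that comes arbitrarily close to the vertices converges to a
   vertex; otherwise it eventually stays on one edge. *)
Lemma cobweb_complete :
  exists l, forall e : R, 0 < e -> exists N, forall i, (N <= i)%N -> pdist l (u i) < e.
Proof.
have [low|/existsNP[e /not_implyP[e0 /existsNP[N high]]]] := pselect (forall e : R,
    0 < e -> forall N, exists2 i, (N <= i)%N & height (\val (u i)) < e).
  exact: cobweb_cauchy_vertex.
apply: (@cobweb_cauchy_edge e N) => // i Ni; rewrite leNgt; apply/negP => hi.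
by apply: high; exists i.
Qed.

End cobweb_cauchy.

(** The hypothesis makes [A] clopen relative to the star of [p]. Each point of the star is joined to
    [p] within the star by a continuous image of the line, which is connected. *)
Lemma star_connected (A : set (cobweb X)) p :
  (forall a, compression a = p -> exists2 e : R, 0 < e & forall b,
     compression b = p -> pdist a b < e -> A a <-> A b) ->
  A (cobweb_vertex p) -> forall a, compression a = p -> A a.
Proof.
move=> Aloc Ap a ap.
have [E|[y [t [py [t01 E]]]]] : \val a = Vertex p \/
    exists y t py t01, \val a = Inner p y t py t01.
  case: a ap => -[v|x y t xy t01] ain; rewrite /compression /=.
    by move=> ->; left.
  move: xy ain => + + xp; rewrite {}xp => xy ain.
  by right; exists y, t, xy, t01.
  by have -> : a = cobweb_vertex p by apply/val_inj.
have td : t <= 1 - Num.min 1 (pdist y p).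
  by apply: (@cobweb_set_inner _ _ _ py t01); rewrite -E; exact: set_valP.
(* Clamping to [[0, t]] lets the path be defined on all of [R]. *)
pose k s := Num.max 0 (Num.min s t).
have k01 s : 0 <= k s <= t.
  by rewrite /k; have [|] := leP s t; have [|] := leP 0 s; have [|] := leP 0 t; move: (t01); lra.
have kL s s' : `|k s - k s'| <= `|s - s'|.
  have := ler_norm (s - s'); have := ler_norm (s' - s); rewrite (distrC s' s) ler_norml.
  rewrite /k; case: (leP s t) => ?; case: (leP s' t) => ?;
   repeat match goal with |- context [Num.max 0 ?x] => case: (leP 0 x) => ? end; move: (t01); lra.
have kin s : edge_point p y (k s) \in @cobweb_set R X.
  by have := k01 s => h; apply: cobweb_setI; move: (t01); lra.
pose g s := cobweb_pt (kin s).
have gp s : compression (g s) = p.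
  by apply: compression_edge_point; have := k01 s; move: (t01); lra.
have gL s s' : pdist (g s) (g s') <= `|s - s'|.
  apply: le_trans (kL s s'); apply: graph_dist_edge => //.
    by have := k01 s; move: (t01); lra.
  by have := k01 s'; move: (t01); lra.
have gloc s : exists2 e : R, 0 < e & forall s', `|s - s'| < e -> A (g s) <-> A (g s').
  have [e e0 eP] := Aloc (g s) (gp s); exists e => // s' ss'.
  by apply: eP => //; exact: le_lt_trans (gL s s') ss'.
(* [g] runs along the spike from [p] to [a] *)
have gT : [set s | A (g s)] = setT.
  have : connected [set: R] by apply/connected_intervalP.
  apply.
  - exists 0; rewrite /=; suff -> : g 0 = cobweb_vertex p by [].
    apply/val_inj => /=; rewrite /k min_l ?maxxx ?edge_point0//.
    by move: (t01); lra.
  - exists [set s | A (g s)]; last by rewrite setTI.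
    rewrite openE => s /= As; apply/nbhs_ballP; have [e e0 eP] := gloc s.
    by exists e => // s' ss'; exact: (eP s' ss').1.
  - exists [set s | A (g s)]; last by rewrite setTI.
    rewrite -[X in closed X]setCK; apply: open_closedC.
    rewrite openE => s /= As; apply/nbhs_ballP; have [e e0 eP] := gloc s.
    by exists e => // s' ss' /= As'; exact/As/(eP s' ss').2.
have -> : a = g t.
  apply/val_inj; rewrite E /= -edge_point_inner /k minxx max_r//.
  by move: (t01); lra.
by have : [set s | A (g s)] t by rewrite gT.
Qed.

End cobweb_geometry.

(** * The iterated cobweb *)

Lemma archi_div (R : realType) (c e : R) : 0 <= c -> 0 < e ->
  exists N, c / N.+1%:R < e.
Proof.
move=> c0 e0; exists (Num.bound (c / e)); rewrite ltr_pdivrMr// mulrC -ltr_pdivrMr//.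
apply: lt_trans (archi_boundP _) _; first by rewrite divr_ge0// ltW.
by rewrite ltr_nat.
Qed.

Section omega.
Context {R : realType} (M : premetric R).
Local Notation E := (cobweb_omega M).
Local Notation L := (iter_cobweb M).
Implicit Types (a b : E) (e r : R).

Lemma iter_cobweb_le3 n (x y : L n) : pdist x y <= 3.
Proof. by case: n x y => [|n] x y; exact: graph_dist_le3. Qed.

Lemma iter_cobweb_eq0 n (x y : L n) : pdist x y = 0 -> x = y.
Proof. by case: n x y => [|n] x y /graph_dist_eq0 xy; apply/val_inj. Qed.

Lemma iter_cobweb_sym n (x y : L n) : pdist x y = pdist y x.
Proof. by case: n x y => [|n] x y; exact: graph_dist_sym. Qed.

Lemma iter_cobweb_triangle n (y x z : L n) :
  pdist x z <= pdist x y + pdist y z.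
Proof. by case: n x y z => [|n] x y z; exact: graph_dist_triangle. Qed.

Lemma iter_cobweb_near n (x : L n.+1) e : 0 < e ->
  exists2 d : R, 0 < d & forall y : L n.+1, pdist x y < d ->
    pdist (compression x) (compression y) < e.
Proof.
move=> e0; have [d d0 dP] := compression_near x.
exists (Num.min d e); first by rewrite lt_min d0.
move=> y; rewrite lt_min => /andP[/dP[->|[_ le]] xye]; first by rewrite pdistxx.
exact: le_lt_trans xye.
Qed.

Definition coord n a : L n := sval a n.

Lemma coord_compression n a : compression (coord n.+1 a) = coord n a.
Proof. exact: (svalP a n). Qed.

Lemma coord_dist n a b : n.+1%:R^-1 * pdist (coord n a) (coord n b) <= mdist a b.
Proof.
apply: sup_upper_bound; last by exists n.
split; first by exists (1%:R^-1 * pdist (coord 0 a) (coord 0 b)), 0%N.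
exists 3 => _ [k _ <-]; rewrite -[leRHS]mul1r.
by rewrite ler_pM ?pdist_ge0 ?invr_ge0 ?iter_cobweb_le3// invf_le1 ?ler1n.
Qed.

Lemma coord_dist_le n a b e : mdist a b < e / n.+1%:R ->
  pdist (coord n a) (coord n b) < e.
Proof.
move=> /(le_lt_trans (coord_dist n a b)); rewrite [ltRHS]mulrC ltr_pM2l//.
Qed.

Lemma omega_dist_le a b e :
  (forall n, n.+1%:R^-1 * pdist (coord n a) (coord n b) <= e) -> mdist a b <= e.
Proof.
move=> eP; apply: sup_le_ub; last by move=> _ [n _ <-]; exact: eP.
by exists (1%:R^-1 * pdist (coord 0 a) (coord 0 b)), 0%N.
Qed.

Lemma coord_dist_scaled n a b e : 0 <= e -> pdist (coord n a) (coord n b) <= e ->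
  n.+1%:R^-1 * pdist (coord n a) (coord n b) <= e.
Proof.
move=> e0 le; rewrite -[leRHS]mul1r.
by rewrite ler_pM ?pdist_ge0 ?invr_ge0// invf_le1 ?ler1n.
Qed.

Lemma coord_eq_le n k a b : coord n a = coord n b -> (k <= n)%N ->
  coord k a = coord k b.
Proof.
elim: n => [|n IH] ab; first by rewrite leqn0 => /eqP ->.
rewrite leq_eqVlt => /predU1P[->//|]; rewrite ltnS; apply: IH.
by rewrite -(coord_compression n a) -(coord_compression n b) ab.
Qed.

(** The coordinates up to [n] contribute nothing; each later one has weight at most [1 / (n + 1)]
    and diameter at most 3. *)
Lemma omega_dist_agree n a b : coord n a = coord n b -> mdist a b <= 3 / n.+1%:R.
Proof.
move=> ab; apply: omega_dist_le => k; have [kn|nk] := leqP k n.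
  by rewrite (coord_eq_le ab kn) pdistxx mulr0 divr_ge0.
rewrite mulrC ler_pM ?pdist_ge0 ?invr_ge0 ?iter_cobweb_le3//.
by rewrite lef_pV2 ?posrE// ler_nat ltnW.
Qed.

(** Past some index the terms stay below [3 / (N + 1)], which is less than the supremum, so only
    finitely many terms compete. The economy argument needs a distance to be one of the terms. *)
Lemma omega_dist_max a b :
  exists n, mdist a b = n.+1%:R^-1 * pdist (coord n a) (coord n b).
Proof.
pose T n := n.+1%:R^-1 * pdist (coord n a) (coord n b).
have T0 n : 0 <= T n by rewrite mulr_ge0 ?invr_ge0 ?pdist_ge0.
have [ab0|ab0] := eqVneq (mdist a b) 0.
  exists 0%N; apply/eqP; rewrite eq_le coord_dist andbT ab0; exact: T0.
have {}ab0 : 0 < mdist a b by rewrite lt_neqAle eq_sym ab0 mdist_ge0.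
have maxT N : exists n, forall k, (k <= N)%N -> T k <= T n.
  elim: N => [|N [n IH]]; first by exists 0%N => k; rewrite leqn0 => /eqP ->.
  have [TT|TT] := leP (T N.+1) (T n).
    by exists n => k; rewrite leq_eqVlt => /predU1P[->//|]; exact: IH.
  exists N.+1 => k; rewrite leq_eqVlt => /predU1P[->//|/IH].
  by move=> /le_trans; apply; exact: ltW.
have [N N3] := @archi_div R 3 (mdist a b) (ler0n _ _) ab0.
have [n nP] := maxT N; exists n; apply/eqP; rewrite eq_le coord_dist andbT.
rewrite leNgt; apply/negP => lt.
have : mdist a b <= Num.max (T n) (3 / N.+1%:R).
  apply: omega_dist_le => k; rewrite le_max; have [kN|Nk] := leqP k N.
    by rewrite nP.
  apply/orP; right; rewrite mulrC ler_pM ?pdist_ge0 ?invr_ge0 ?iter_cobweb_le3//.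
  by rewrite lef_pV2 ?posrE// ler_nat ltnW.
by rewrite leNgt gt_max lt N3.
Qed.

(** Coordinates below [n] are forced by compression, those above come from the sections [f]. To
    avoid a case distinction between dependent types, the induction starts one level lower at
    [compression y] and alters [f n] so that it sends this point to [y]. *)
Lemma omega_extend (f : forall k, L k -> L k.+1) :
  (forall k w, compression (f k w) = w) -> forall n (y : L n),
  exists2 a, coord n a = y & forall k, (n <= k)%N -> coord k.+1 a = f k (coord k a).
Proof.
move=> fK n; elim: n f fK => [|n IH] f fK y.
  pose c := fix c n : L n := if n is n'.+1 then f n' (c n') else y.
  have cK n : compression (c n.+1) = c n by exact: fK.
  by exists (exist _ c cK).
pose g w : L n.+1 := if pselect (w = compression y) then y else f n w.
have gK w : compression (g w) = w by rewrite /g; case: pselect => [E|] //=.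
have [|a an ak] := IH (@dfwith _ _ f n g) _ (compression y).
  move=> k; have [->|kn] := eqVneq k n; first by rewrite dfwithin.
  by rewrite dfwithout// eq_sym.
have E : coord n.+1 a = y.
  by rewrite ak// dfwithin an /g; case: pselect.
exists a => // k nk; rewrite ak ?dfwithout//; last exact: ltnW.
by rewrite neq_ltn nk.
Qed.

Lemma coord_near n a e : 0 < e -> exists2 d : R, 0 < d & forall b,
  pdist (coord n a) (coord n b) < d -> forall k, (k <= n)%N ->
  pdist (coord k a) (coord k b) < e.
Proof.
move=> e0; elim: n => [|n [d d0 dP]].
  by exists e => // b ab k; rewrite leqn0 => /eqP ->.
have [d' d'0 d'P] := iter_cobweb_near (coord n.+1 a) d0.
exists (Num.min d' e); first by rewrite lt_min d'0.
move=> b; rewrite lt_min => /andP[abd abe] k.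
rewrite leq_eqVlt => /predU1P[->//|]; rewrite ltnS; apply: dP.
by have := d'P _ abd; rewrite !coord_compression.
Qed.

Definition vertex_from n a :=
  forall k, (n <= k)%N -> coord k.+1 a = cobweb_vertex (coord k a).

Lemma vertex_extend n (y : L n) : exists2 a, coord n a = y & vertex_from n a.
Proof. exact: (@omega_extend (fun k w => cobweb_vertex w)). Qed.

(** Above [n] the coordinates of [a] are vertices, so [compression_lift] applies at every level with
    the same bound [r], which never grows. Below [n] the coordinates of [b] are compressions of [q],
    and [coord_near] controls them. *)
Lemma omega_lift n a e : vertex_from n a -> 0 < e -> exists2 d : R, 0 < d &
  forall q : L n, pdist (coord n a) q < d -> exists2 b, coord n b = q & mdist a b < e.
Proof.
move=> va e0; have e20 : 0 < e / 2 by rewrite divr_gt0.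
have [d d0 dP] := coord_near n a e20.
pose r := Num.min (Num.min d 1) (e / 2).
have r0 : 0 < r by rewrite !lt_min d0 e20 ltr01.
have r1 : r <= 1 by rewrite !ge_min lexx orbT.
exists r => // q aq.
(* The sections must be total: where [w] is farther than [r], the vertex over [w] is an arbitrary
   default. *)
have fP (k : nat) (w : L k) : exists v : L k.+1, compression v = w /\
    (pdist (coord k a) w <= r -> pdist (cobweb_vertex (coord k a) : L k.+1) v <= r).
  have [le|nle] := pselect (pdist (coord k a) w <= r).
    by have [v] := compression_lift r0 r1 le; exists v.
  by exists (cobweb_vertex w).
pose f k w := projT1 (cid (fP k w)).
have fE k w := projT2 (cid (fP k w)).
have [b bn bk] := omega_extend (fun k w => (fE k w).1) q.
exists b => //.
have up k : (n <= k)%N -> pdist (coord k a) (coord k b) <= r.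
  elim: k => [|k IH]; first by rewrite leqn0 => /eqP n0; move: aq; rewrite -bn n0 => /ltW.
  rewrite leq_eqVlt => /predU1P[<-|]; first by rewrite bn ltW.
  rewrite ltnS => nk; rewrite va// bk//.
  by apply: (fE k (coord k b)).2; exact: IH.
apply: (@le_lt_trans _ _ (e / 2)); last by rewrite ltr_pdivrMr// ltr_pMr// ltr1n.
apply: omega_dist_le => k; apply: coord_dist_scaled; first exact: ltW.
have [kn|nk] := leqP k n; last first.
  by apply: le_trans (up _ (ltnW nk)) _; rewrite ge_min lexx orbT.
apply/ltW/dP => //; rewrite bn; apply: lt_le_trans aq _.
by rewrite !ge_min lexx.
Qed.

Lemma omega_lift_base a e : coord 0 a = cobweb_vertex (compression_omega a) ->
  vertex_from 0 a -> 0 < e -> exists2 d : R, 0 < d & forall q : M,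
    pdist (compression_omega a) q < d ->
    exists2 b, compression_omega b = q & mdist a b < e.
Proof.
move=> a0 va e0; have [d d0 dP] := omega_lift va e0.
(* Halving turns the weak bound [<= r] of [compression_lift] into the strict bound that [dP]
   expects. *)
pose r := Num.min d 1 / 2.
have m0 : 0 < Num.min d 1 by rewrite lt_min d0 ltr01.
have rd : r < Num.min d 1 by rewrite ltr_pdivrMr// ltr_pMr// ltr1n.
have r0 : 0 < r by rewrite divr_gt0.
exists r => // q /ltW aq.
have [|y yq ay] := compression_lift r0 _ aq.
  by rewrite (le_trans (ltW rd))// ge_min lexx orbT.
have [|b by_ ab] := dP y; last by exists b => //; rewrite /compression_omega -/(coord 0 b) by_.
by rewrite a0; apply: le_lt_trans ay (lt_le_trans rd _); rewrite ge_min lexx.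
Qed.

Lemma vertex_extend_base (p : M) : exists a, [/\ compression_omega a = p,
  coord 0 a = cobweb_vertex (compression_omega a) & vertex_from 0 a].
Proof.
have [a a0 va] := @vertex_extend 0 (cobweb_vertex p); exists a.
by rewrite a0 /compression_omega -/(coord 0 a) a0; split.
Qed.

End omega.

(** * Connected fibres, completeness and economy of [cobweb_omega M] *)

Section omega_topology.
Context {R : realType} (M : premetric R).
Local Notation E := (cobweb_omega M).
Local Notation L := (iter_cobweb M).
Implicit Types (a b : E) (e r : R).

Section fibres.
Context (Phi : set E) (U : set E) (Uloc : forall a, Phi a -> exists2 e : R, 0 < e &
  forall b, Phi b -> mdist a b < e -> U a <-> U b).

(* [U] is clopen in [Phi]; [z] is mixed if both [U] and its complement in [Phi] have
   points over [z]. *)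
Let mixed T (P : E -> T) z := exists a b,
  [/\ Phi a, Phi b, P a = z, P b = z & U a /\ ~ U b].

(** If no point of the star of [z] were mixed, [U] would be constant on the fibres of [P] over that
    star and would descend to a set [A] there. By [lift], [A] is clopen in the star, so
    [star_connected] makes it all or nothing, and [z] would not be mixed. *)
Let mixed_step (N : premetric R) (P : E -> cobweb N) z :
  (forall y : cobweb N, exists2 a, P a = y & forall e, 0 < e -> exists2 d : R, 0 < d &
     forall w, pdist y w < d -> exists2 b, P b = w & mdist a b < e) ->
  (forall a, compression (P a) = z -> Phi a) ->
  mixed (fun a => compression (P a)) z -> exists2 y, compression y = z & mixed P y.
Proof.
move=> lift PhiP [a0 [b0 [Phia0 Phib0 a0z b0z [Ua0 nUb0]]]].
apply: contrapT => nomix.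
have same a b : compression (P a) = z -> P a = P b -> U a -> U b.
  move=> az ab Ua; apply: contrapT => nUb; apply: nomix; exists (P a) => //.
  exists a, b; split=> //; [exact: PhiP|apply: PhiP; rewrite -ab//].
have same2 a b : compression (P a) = z -> P a = P b -> U a <-> U b.
  by move=> az ab; split; apply: same => //; rewrite -ab.
pose A : set (cobweb N) := [set y | exists2 a, P a = y & U a].
have AE a : compression (P a) = z -> A (P a) <-> U a.
  move=> az; split=> [[b ba Ub]|Ua]; last by exists a.
  by apply/(same2 b a); rewrite ?ba.
have Aloc y : compression y = z -> exists2 e : R, 0 < e & forall w,
    compression w = z -> pdist y w < e -> A y <-> A w.
  have [a ay aP] := lift y; rewrite -ay => az.
  have [e e0 eP] := Uloc (PhiP _ az).
  have [d d0 dP] := aP e e0; exists d => // w wz; rewrite ay => /dP[b bw ab].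
  rewrite -bw -ay; rewrite -bw in wz; rewrite AE// AE//.
  by apply: eP => //; exact: PhiP.
have AClocr y : compression y = z -> exists2 e : R, 0 < e & forall w,
    compression w = z -> pdist y w < e -> (~` A) y <-> (~` A) w.
  by move=> /Aloc[e e0 eP]; exists e => // w wz /(eP w wz)/not_iff_compat.
have [Az|nAz] := pselect (A (cobweb_vertex z)).
  by apply: nUb0; apply/(AE b0 b0z); exact: star_connected Aloc Az _ b0z.
by apply: (star_connected AClocr nAz a0z); apply/(AE a0 a0z).
Qed.

(** In the application [F] consists of the points of [decomp X] with a given value, which are at
    mutual distance 0. *)
Lemma fibre_connected (F : set M) : Phi = @compression_omega R M @^-1` F ->
  (forall p q, F p -> F q -> pdist p q = 0) ->
  forall a b, Phi a -> Phi b -> U a -> U b.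
Proof.
move=> PhiE F0 a0 b0 Phia0 Phib0 Ua0; apply: contrapT => nUb0.
have PhiF a : Phi a <-> F (compression_omega a) by rewrite PhiE.
(* Otherwise the vertex sequence [a] over the base point of [a0] lies in [U]. Since [F] has diameter
   0, a point [b] over the base point of [b0] exists as near to [a] as desired; so [b] is in [U] and
   [b0] is not, over the same base point. *)
have [p Fp mixp] : exists2 p, F p & mixed (@compression_omega R M) p.
  apply: contrapT => nomix.
  have [a [ap a0v av]] := vertex_extend_base (compression_omega a0).
  have Fa0 : F (compression_omega a0) by apply/PhiF.
  have Phia : Phi a by apply/PhiF; rewrite ap.
  have Ua : U a.
    apply: contrapT => nUa; apply: nomix; exists (compression_omega a0) => //.
    by exists a0, a.
  have [e e0 eP] := Uloc Phia.
  have [d d0 dP] := omega_lift_base a0v av e0.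
  have [|b bq ab] := dP (compression_omega b0).
    by rewrite F0// ?ap//; apply/PhiF.
  have Phib : Phi b by apply/PhiF; rewrite bq; apply/PhiF.
  apply: nomix; exists (compression_omega b0); first exact/PhiF.
  by exists b, b0; split=> //; split=> //; apply/(eP b).
have liftL n (y : L n) : exists2 a, coord n a = y & forall e, 0 < e ->
    exists2 d : R, 0 < d & forall w : L n, pdist y w < d ->
    exists2 b, coord n b = w & mdist a b < e.
  have [a ay va] := vertex_extend y; exists a => // e e0.
  have [d d0 dP] := omega_lift va e0; exists d => // w; rewrite -ay; exact: dP.
have PhiL n a b : coord n a = coord n b -> Phi a -> Phi b.
  move=> /coord_eq_le/(_ (leq0n n)) ab; rewrite !PhiF /compression_omega.
  by rewrite -/(coord 0 a) -/(coord 0 b) ab.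
have [y0 y0p mix0] : exists2 y : L 0, compression y = p & mixed (coord 0) y.
  apply: (@mixed_step M (coord 0)) => //; first exact: (liftL 0%N).
  by move=> a ap; apply/PhiF; rewrite /compression_omega -/(coord 0 a) ap.
have fP n (z : L n) : exists y : L n.+1, compression y = z /\
    (mixed (coord n) z -> mixed (coord n.+1) y).
  have [mz|nz] := pselect (mixed (coord n) z); last by exists (cobweb_vertex z).
  have [||y yz my] := @mixed_step (L n) (coord n.+1) z (liftL n.+1); last by exists y.
    have [a [b [Phia _ az _ _]]] := mz.
    move=> c cz; apply: (PhiL n a) => //; rewrite az -cz; exact: coord_compression.
  have [a [b [? ? az bz ?]]] := mz; exists a, b; split=> //=.
    by rewrite coord_compression.
  by rewrite coord_compression.
pose f n z := projT1 (cid (fP n z)).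
have fE n z := projT2 (cid (fP n z)).
have [l l0 lS] := omega_extend (fun n z => (fE n z).1) y0.
have mixl n : mixed (coord n) (coord n l).
  elim: n => [|n IH]; first by rewrite l0.
  by rewrite lS//; apply: (fE n _).2.
have Phil : Phi l by have [a [_ [Phia _ al _ _]]] := mixl 0%N; exact: PhiL al Phia.
have [e e0 eP] := Uloc Phil.
have [N N3] := @archi_div R 3 e (ler0n _ _) e0.
have [a [b [Phia Phib al bl [Ua nUb]]]] := mixl N.
have near c : coord N c = coord N l -> mdist l c < e.
  by move=> cl; apply: le_lt_trans N3; exact: omega_dist_agree.
by apply/nUb/(eP b Phib (near b bl))/(eP a Phia (near a al)).
Qed.

End fibres.

(** The centres [u n] of small balls of the filter form a Cauchy sequence in each coordinate.
    Continuity of compression makes the coordinatewise limits compatible, and the bound [zu],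
    uniform over the coordinates, gives convergence in the metric. *)
Lemma omega_complete : complete_space E.
Proof.
move=> F FF Fc.
have /choice[u uP] : forall n, exists x : E, F (ball x n.+1%:R^-1).
  move=> n; have n0 : 0 < n.+1%:R^-1 :> R by rewrite invr_gt0.
  have /(_ _ _ n0)[[A B] /= [FA FB] AB] := (cauchy_ballP F).2 Fc.
  have [x Bx] := filter_ex FA; exists x; apply: filterS FB => y By.
  exact: (AB (x, y)).
have uij i j : mdist (u i) (u j) < i.+1%:R^-1 + j.+1%:R^-1.
  have [x [xi xj]] := filter_ex (filterI (uP i) (uP j)).
  rewrite !ballEmdist /= in xi xj.
  apply: le_lt_trans (metric_triangle _ x _) _; apply: ltrD => //.
  by rewrite metric_sym.
have uc n e : 0 < e -> exists N, forall i j, (N <= i)%N -> (N <= j)%N ->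
    pdist (coord n (u i)) (coord n (u j)) < e.
  move=> e0; have en0 : 0 < e / n.+1%:R by rewrite divr_gt0.
  have [N NP] := @archi_div R 2 (e / n.+1%:R) (ler0n _ _) en0.
  exists N => i j Ni Nj; apply: coord_dist_le.
  apply: lt_le_trans (uij i j) (le_trans _ (ltW NP)).
  by rewrite mulrDl mul1r lerD// lef_pV2 ?posrE// ler_nat.
have lP n : exists l : L n, forall e : R, 0 < e ->
    exists N, forall i, (N <= i)%N -> pdist l (coord n (u i)) < e.
  by case: n (uc n) => [|n] ucn; exact: (cobweb_complete ucn).
pose l n := projT1 (cid (lP n)); have lE n := projT2 (cid (lP n)).
have lK n : compression (l n.+1) = l n.
  apply: iter_cobweb_eq0; apply/eqP; rewrite eq_le pdist_ge0 andbT.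
  apply/ler_addgt0Pr => e e0; rewrite add0r.
  have e20 : 0 < e / 2 by rewrite divr_gt0.
  have [d d0 dP] := iter_cobweb_near (l n.+1) e20.
  have [N1 N1P] := lE n.+1 d d0; have [N2 N2P] := lE n _ e20.
  have := dP _ (N1P (maxn N1 N2) (leq_maxl _ _)).
  rewrite coord_compression => le1.
  have le2 := N2P (maxn N1 N2) (leq_maxr _ _).
  apply: le_trans (iter_cobweb_triangle (coord n (u (maxn N1 N2))) _ _) _.
  by rewrite [leRHS]splitr (iter_cobweb_sym _ (l n)) lerD// ltW.
pose z : E := exist _ l lK; exists z.
have zu k : mdist z (u k) <= 2 / k.+1%:R.
  apply: omega_dist_le => n; apply/ler_addgt0Pr => e e0.
  have [N NP] := lE n e e0; pose i := maxn N k.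
  have zi := NP i (leq_maxl _ _).
  apply: le_trans (_ : n.+1%:R^-1 * (pdist (l n) (coord n (u i)) +
    pdist (coord n (u i)) (coord n (u k))) <= _).
    by rewrite ler_pM2l ?invr_gt0//; exact: iter_cobweb_triangle.
  rewrite mulrDr addrC lerD//.
    apply: le_trans (coord_dist n _ _) (le_trans (ltW (uij _ _)) _).
    by rewrite mulrDl mul1r lerD// lef_pV2 ?posrE// ler_nat ltnS leq_maxr.
  rewrite -[leRHS]mul1r ler_pM ?pdist_ge0 ?invr_ge0//; last exact: ltW.
  by rewrite invf_le1// ler1n.
move=> V /nbhs_ballP[e /= e0 eV].
(* The 3 is 2 from [zu] plus 1 for the radius of the ball around [u k]. *)
have [k kP] := @archi_div R 3 e (ler0n _ _) e0.
apply: filterS (uP k) => x; rewrite ballEmdist /= => ux; apply: eV.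
rewrite ballEmdist /=; apply: le_lt_trans (metric_triangle z (u k) x) _.
apply: lt_trans kP; have := zu k; move: ux; set i := _^-1; lra.
Qed.

Lemma omega_economical : economical E.
Proof.
move=> A Ainf.
have dA : dense_subset A A by split=> //; exact: subset_closure.
have [D [dAD Dmin]] : exists D, dense_subset A D /\
    forall D', dense_subset A D' -> D #<= D'.
  have [|D] := @card_le_minimum E (dense_subset A); first by exists A.
  by move=> dD Dm; exists D.
rewrite /dens; case: xgetP => [{dAD Dmin}D _ [[DA AD] _]|/(_ D)[]//].
(* A finite [D] would be closed, hence would contain [A]. *)
have Dinf : infinite_set D.
  move=> Dfin; apply: Ainf; apply: sub_finite_set (Dfin) => a /AD.
  have : closed D.
    pose h1 := hausdorff_accessible (@metric_hausdorff _ E).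
    exact: (accessible_finite_set_closed.1 h1 D Dfin).
  by move=> /closure_id <-.
(* The two values of [i] match the two alternatives of [compression_near], applied at coordinate
   [n + 1]. *)
pose c (i : bool) n (d : E) : L n :=
  if i then compression (coord n.+1 d) else nearest (\val (coord n.+1 d)).
have cP n a : A a -> exists i d, D d /\ coord n a = c i n d.
  move=> Aa; have [r r0 rP] := compression_near (coord n.+1 a).
  have r0' : 0 < r / n.+2%:R by rewrite divr_gt0.
  have [d [Dd]] := AD a Aa _ (nbhsx_ballx a _ r0').
  rewrite ballEmdist /= => /coord_dist_le/rP; rewrite (coord_compression n a).
  by case=> [<-|[-> _]]; [exists true, d|exists false, d].
have H := @countable_infinite_card_leX (nat * bool * bool)%type _ _ Dinf.
apply: (card_le_trans _ H).
apply: (@subset_image_card_le _ _ _ _ (fun q : (nat * bool * bool) * (E * E) =>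
  let: ((n, i, j), (d, d')) := q in n.+1%:R^-1 * pdist (c i n d) (c j n d'))).
move=> _ [[a b] [/= Aa Ab] <-]; have [n ->] := omega_dist_max a b.
have [i [d [Dd ->]]] := cP n a Aa; have [j [d' [Dd' ->]]] := cP n b Ab.
by exists ((n, i, j), (d, d')).
Qed.

End omega_topology.

(** * The resolution map *)

Section quotient_maps.
Context {X Y : topologicalType} (f : X -> Y).

Lemma monotone_quotient_connected : monotone_map f -> quotient_map f ->
  connected [set: X] <-> connected [set: Y].
Proof.
move=> [fsurj fconn] [_ fopen].
have fclosed U : closed U <-> closed (f @^-1` U).
  by rewrite -(openC U) -(openC (f @^-1` U)) preimage_setC fopen.
split=> conn B [z Bz] [C oC]; rewrite setTI => BC [D cD]; rewrite setTI => BD.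
  have fBT : f @^-1` B = setT.
    apply: conn; first by have [x xz] := fsurj z; exists x; rewrite /= xz.
      by exists (f @^-1` B); rewrite ?setTI// -fopen BC.
    by exists (f @^-1` B); rewrite ?setTI// -fclosed BD.
  apply/seteqP; split=> // y _; have [x <-] := fsurj y.
  by have : (f @^-1` B) x by rewrite fBT.
(* Connected fibres make the clopen set [B] saturated, so its image is clopen in [Y]. *)
have sat x x' : f x = f x' -> B x -> B x'.
  move=> xx' Bx; have fx : (B `&` f @^-1` [set f x]) = f @^-1` [set f x].
    apply: fconn; first by exists x.
      by exists C => //; rewrite setIC BC.
    by exists D => //; rewrite setIC BD.
  have : (f @^-1` [set f x]) x' by [].
  by rewrite -fx => -[].
have fB : f @^-1` (f @` B) = B.
  by apply/seteqP; split=> x; [move=> [x' Bx' x'x]; exact: sat Bx'|exists x].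
have fBT : f @` B = setT.
  apply: conn; first by exists (f z), z.
    by exists (f @` B); rewrite ?setTI// fopen fB BC.
  by exists (f @` B); rewrite ?setTI// fclosed fB BD.
by rewrite -fB fBT preimage_setT.
Qed.

End quotient_maps.

Lemma open_set_type (X : topologicalType) (A : set X) (U : set A) :
  open U <-> exists2 V : set X, open V & U = \val @^-1` V.
Proof. by split=> -[V oV VU]; exists V. Qed.

Lemma metric_openP (R : realType) (T : metricType R) (U : set T) :
  open U <-> forall x, U x -> exists2 e : R, 0 < e & forall y, mdist x y < e -> U y.
Proof.
rewrite openE; split=> oU x Ux.
  have /nbhs_ballP[e /= e0 eU] := oU x Ux.
  by exists e => // y xy; apply: eU; rewrite ballEmdist.
have [e e0 eU] := oU x Ux; apply/nbhs_ballP; exists e => // y.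
by rewrite ballEmdist; exact: eU.
Qed.

Lemma open_sequentially_open (X : topologicalType) (V : set X) :
  open V -> sequentially_open V.
Proof.
move=> oV u x Vx ux; have /ux[N _ NV] : nbhs x V by exact: open_nbhs_nbhs.
by exists N => m /NV.
Qed.

Lemma sequentially_openPn (X : topologicalType) (V : set X) :
  ~ sequentially_open V ->
  exists u x, [/\ V x, u @ \oo --> x & forall n : nat, ~ V (u n)].
Proof.
move=> /existsNP[u /existsNP[x /not_implyP[Vx /not_implyP[ux nV]]]].
have mP n : exists m, (n <= m)%N /\ ~ V (u m).
  apply: contrapT => h; apply: nV; exists n => m nm; apply: contrapT => nVm.
  by apply: h; exists m.
(* [m] need not be increasing: [n <= m n] is enough for [u \o m] to converge to [x]. *)
have [m mE] := choice mP; exists (u \o m), x; split=> // [|n]; last exact: (mE n).2.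
move=> W /ux[N _ NW]; exists N => // n /= Nn; apply: NW => /=.
exact: leq_trans (mE n).1.
Qed.

Lemma sequential_spaceP (X : topologicalType) : sequential_space X <->
  forall V : set X, sequentially_open V -> open V.
Proof.
split=> [seqX V sV|sX A nA].
  rewrite -closedC; apply: contrapT => /seqX[u [x [nVu /contrapT Vx ux]]].
  by have [N NV] := sV u x Vx ux; exact: nVu (NV N (leqnn _)).
have : ~ sequentially_open (~` A) by move=> /sX; rewrite openC.
move=> /sequentially_openPn[u [x [nAx ux Au]]]; exists u, x; split=> // n.
by apply: contrapT; exact: Au n.
Qed.

(** * Convergent sequences as continuous maps on [S0] *)

Section sequence_map.
Context (R : realType) {X : topologicalType} (u : nat -> X) (x : X).

Definition seq_fun (t : S0 R) : X :=
  if pselect (exists n, t = S0_inv R n) is left h then u (projT1 (cid h)) else x.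

Lemma S0_inv_inj : injective (S0_inv R).
Proof.
move=> m n /(congr1 \val) /= /eqP; rewrite (inj_eq invr_inj).
by rewrite eqr_nat => /eqP[].
Qed.

Lemma seq_fun_inv n : seq_fun (S0_inv R n) = u n.
Proof.
rewrite /seq_fun; case: pselect => [h|[]]; last by exists n.
by case: (cid h) => /= m /S0_inv_inj ->.
Qed.

Lemma seq_fun0 : seq_fun (S0_0 R) = x.
Proof.
rewrite /seq_fun; case: pselect => // h; exfalso; have [n /(congr1 \val) /= E] := h.
by have /eqP := esym E; rewrite invr_eq0 pnatr_eq0.
Qed.

Lemma S0_inv_isolated n : exists2 d : R, 0 < d & forall s : S0 R,
  `|\val (S0_inv R n) - \val s| < d -> s = S0_inv R n.
Proof.
pose d1 : R := n.+1%:R^-1 - n.+2%:R^-1.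
(* The point 1 of [S0] has no neighbour above it, so for [n = 0] any positive value would do. *)
pose d2 : R := if n is n'.+1 then n'.+1%:R^-1 - n'.+2%:R^-1 else 1.
have d10 : 0 < d1 by rewrite subr_gt0 ltf_pV2 ?posrE// ltr_nat.
have d20 : 0 < d2.
  by rewrite /d2; case: n {d1 d10 d2} => // n; rewrite subr_gt0 ltf_pV2 ?posrE// ltr_nat.
exists (Num.min d1 d2); first by rewrite lt_min d10.
move=> s; rewrite lt_min ltr_norml => /andP[/andP[_ h1] ].
rewrite ltr_norml => /andP[h2 _].
have [s0|[m sm]] := S0P s.
  move: h1; rewrite s0 /= subr0 /d1 ltrBrDr gtrDl => /ltW.
  by rewrite leNgt invr_gt0 ltr0n.
rewrite sm; congr S0_inv; move: h1 h2; rewrite sm /= /d1 ltrD2l ltrN2 => h1 h2.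
apply/eqP; rewrite eqn_leq; apply/andP; split.
  by move: h1; rewrite ltf_pV2 ?posrE// ltr_nat ltnS.
move: h2; rewrite /d2; case: n {d1 d10 d2 d20 h1} => // n h2.
by move: h2; rewrite opprB ltrD2l ltrN2 ltf_pV2 ?posrE// ltr_nat ltnS.
Qed.

Lemma seq_fun_continuous : u @ \oo --> x -> continuous seq_fun.
Proof.
move=> ux t V; have [->|[n ->]] := S0P t; last first.
  rewrite seq_fun_inv => /nbhs_singleton Vn; apply/nbhs_ballP.
  have [d d0 dP] := S0_inv_isolated n; exists d => // s /dP ->.
  by rewrite /= seq_fun_inv.
rewrite seq_fun0 => Vx; have [N _ NV] := ux _ Vx; apply/nbhs_ballP.
exists N.+1%:R^-1; first by rewrite /= invr_gt0.
move=> s; have [->|[m ->]] := S0P s.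
  by move=> _; rewrite /= seq_fun0; exact: nbhs_singleton.
rewrite /ball /= /initial_ball /= /ball /= sub0r normrN ger0_norm ?invr_ge0//.
rewrite ltf_pV2 ?posrE// ltr_nat ltnS => /ltnW Nm.
by rewrite /= seq_fun_inv; exact: NV.
Qed.

End sequence_map.

(** * Topological properties of the resolution map *)

Section resolution_topology.
Context (R : realType) (X : topologicalType).
Local Notation E := (resolution R X).
Local Notation xi := (@resolution_map R X).
Implicit Types (a b : E) (V : set X).

Lemma decomp_dist_lt1 (p q : decomp R X) : pdist p q < 1 ->
  calc p = calc q \/ p.1 = q.1 /\ pdist p q = `|\val p.2 - \val q.2|.
Proof.
rewrite /= /decomp_dist /calc; case: pselect => [E _|nE]; first by left.
by case: pselect => [E _|nE'] /=; [right|rewrite ltxx].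
Qed.

Lemma decomp_dist_calc (p q : decomp R X) : calc p = calc q -> pdist p q = 0.
Proof. by rewrite /= /decomp_dist /calc; case: pselect. Qed.

Lemma decomp_dist_le (f : continuousType (S0 R) X) (t s : S0 R) :
  pdist ((f, t) : decomp R X) (f, s) <= `|\val t - \val s|.
Proof. by rewrite /= /decomp_dist; do 2 case: pselect => //=. Qed.

(** A move of length less than 1 either keeps the value of [calc] or stays on the same map [f]; in
    [S0], points arbitrarily close to [t] with values outside [V] would give a sequence
    contradicting sequential openness. *)
Lemma decomp_near (p : decomp R X) V : sequentially_open V -> V (calc p) ->
  exists2 d : R, 0 < d & forall q, pdist p q < d -> V (calc q).
Proof.
move=> sV; case: p => f t Vp.
have [d d0 dP] : exists2 d : R, 0 < d & forall s, `|\val t - \val s| < d -> V (f s).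
  apply: contrapT => h.
  have sP n : exists s : S0 R, `|\val t - \val s| < n.+1%:R^-1 /\ ~ V (f s).
    apply: contrapT => h'; apply: h; exists n.+1%:R^-1; first by rewrite invr_gt0.
    by move=> s ts; apply: contrapT => nV; apply: h'; exists s.
  have [s sE] := choice sP.
  have st : s @ \oo --> t.
    move=> W /nbhs_ballP[e /= e0 eW].
    have [N N1] := @archi_div R 1 e ler01 e0; exists N => // n /= Nn; apply: eW.
    apply: lt_trans (sE n).1 (le_lt_trans _ N1).
    by rewrite mul1r lef_pV2 ?posrE// ler_nat ltnS.
  have fst : (f \o s) @ \oo --> f t := cvg_comp _ _ st (@cts_fun _ _ f t).
  have [N NV] := sV _ _ Vp fst.
  exact: (sE N).2 (NV N (leqnn _)).
exists (Num.min d 1); first by rewrite lt_min d0 ltr01.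
move=> q; rewrite lt_min => /andP[pqd /decomp_dist_lt1[<-//|[fq pq]]].
by rewrite /calc -fq; apply: dP; rewrite -pq.
Qed.

Lemma resolution_near a V : sequentially_open V -> V (xi a) ->
  exists2 e : R, 0 < e & forall b, mdist a b < e -> V (xi b).
Proof.
move=> sV Va; have [d d0 dP] := decomp_near sV Va.
have [e e0 eP] := compression_near (coord 0 a).
have m0 : 0 < Num.min e d by rewrite lt_min e0.
exists (Num.min e d / 1%:R); first by rewrite divr1.
move=> b /coord_dist_le; rewrite lt_min => /andP[/eP ab abd].
rewrite /resolution_map /compression_omega -/(coord 0 b).
case: ab => [->//|[_ le]]; apply: dP; exact: le_lt_trans abd.
Qed.

Lemma resolution_surjective : surjective_map xi.
Proof.
move=> x; have cx : continuous (fun _ : S0 R => x) by exact: cst_continuous.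
pose f : continuousType (S0 R) X := mkcts cx.
have [a [ap _ _]] := vertex_extend_base ((f, S0_0 R) : decomp R X).
by exists a; rewrite /resolution_map ap.
Qed.

(** One point [a] over the limit is approached by points over the terms; both the quotient and the
    hereditarily quotient property rest on this. *)
Lemma resolution_lift_seq (u : nat -> X) x : u @ \oo --> x -> exists a, xi a = x /\
  forall e : R, 0 < e -> exists N, forall n, (N <= n)%N ->
    exists2 b, xi b = u n & mdist a b < e.
Proof.
move=> ux; pose f : continuousType (S0 R) X := mkcts (seq_fun_continuous ux).
have [a [ap a0 va]] := vertex_extend_base ((f, S0_0 R) : decomp R X).
exists a; split; first by rewrite /resolution_map ap /calc /= /mkcts seq_fun0.
move=> e e0; have [d d0 dP] := omega_lift_base a0 va e0.
have [N N1] := @archi_div R 1 d ler01 d0; exists N => n Nn.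
have [|b bq ab] := dP ((f, S0_inv R n) : decomp R X); last first.
  by exists b => //; rewrite /resolution_map bq /calc /= /mkcts seq_fun_inv.
rewrite ap; apply: le_lt_trans (decomp_dist_le _ _ _) _.
rewrite sub0r normrN ger0_norm ?invr_ge0//; apply: le_lt_trans N1.
by rewrite mul1r lef_pV2 ?posrE// ler_nat ltnS.
Qed.

Lemma resolution_openP V : sequentially_open V <-> open (xi @^-1` V).
Proof.
split=> [sV|/metric_openP oV u x Vx ux].
  by apply/metric_openP => a Va; exact: resolution_near.
have [a [ax aP]] := resolution_lift_seq ux.
have [|e e0 eV] := oV a; first by rewrite /= ax.
have [N NP] := aP e e0; exists N => m /NP[b <-]; exact: eV.
Qed.

Lemma resolution_quotient_s : quotient_map (@resolution_map_s R X).
Proof. by split; [exact: resolution_surjective|exact: resolution_openP]. Qed.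

Lemma resolution_monotone_s : monotone_map (@resolution_map_s R X).
Proof.
split=> [|y B [b0 Bb0] [C oC BC] [D cD BD]]; first exact: resolution_surjective.
have Uloc a : (xi @^-1` [set y]) a -> exists2 e : R, 0 < e & forall b,
    (xi @^-1` [set y]) b -> mdist a b < e -> B a <-> B b.
  move=> ay; have [Ba|nBa] := pselect (B a).
    have Ca : C a by move: Ba; rewrite BC => -[].
    have [e e0 eC] := (metric_openP C).1 oC a Ca; exists e => // b by_ ab.
    by split=> // _; rewrite BC; split=> //; exact: eC.
  have nDa : (~` D) a by move=> Da; apply: nBa; rewrite BD.
  have [e e0 eD] := (metric_openP _).1 (closed_openC cD) a nDa.
  exists e => // b by_ ab; split=> // Bb; exfalso.
  by apply: (eD b ab); move: Bb; rewrite BD => -[].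
apply/seteqP; split=> b; first by rewrite BC => -[].
move=> by_; apply: (fibre_connected Uloc (F := @calc R X @^-1` [set y])) (Bb0) => //.
  by move=> p q /= py qy; apply: decomp_dist_calc; rewrite py qy.
by move: Bb0; rewrite BC => -[].
Qed.

Lemma resolution_quotientP : quotient_map xi <-> sequential_space X.
Proof.
rewrite sequential_spaceP; split=> [[_ qV] V sV|sX].
  by apply/qV/resolution_openP.
split; first exact: resolution_surjective.
move=> V; rewrite -resolution_openP; split; first exact: open_sequentially_open.
exact: sX.
Qed.

Lemma resolution_hereditarily_quotientP :
  hereditarily_quotient_map xi <-> Frechet_Urysohn_space X.
Proof.
split=> [[_ hq] A x clAx|FU].
  have [Ax|nAx] := pselect (A x).
    by exists (fun=> x); split=> //; exact: cvg_cst.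
  (* Were no point over [x] a limit of points over [A], the preimage of the singleton [U] would be
     open over [B]. Then [U] would be open in [B], although [x] is in the closure of [A]. *)
  pose B := A `|` [set x].
  have [_ qB] := hq B.
  pose U : set B := [set y | \val y = x].
  have [a [ax aP]] : exists a, xi a = x /\
      forall e : R, 0 < e -> exists b, mdist a b < e /\ A (xi b).
    apply: contrapT => noa.
    have : open U.
      apply/qB/open_set_type.
      pose W : set E := [set a | exists2 e : R, 0 < e & forall b, mdist a b < e -> ~ A (xi b)].
      exists W.
        apply/metric_openP => a [e e0 eP]; have e20 : 0 < e / 2 by rewrite divr_gt0.
        exists (e / 2) => // b ab; exists (e / 2) => // c bc; apply: eP.
        by apply: le_lt_trans (metric_triangle a b c) _; rewrite [ltRHS]splitr ltrD.
      apply/seteqP; split=> [[w wB]|[w wB]] /=.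
        move=> wx; apply: contrapT => nW; apply: noa; exists w; split=> // e e0.
        apply: contrapT => h; apply: nW; exists e => // b wb Ab; apply: h.
        by exists b.
      move=> [e e0 eP]; have [/= Aw|//] : B (xi w) by exact: (set_mem wB).
      by case: (eP w); rewrite ?mdistxx.
    move=> /open_set_type[V oV UV].
    have Vx : V x.
      have xB : x \in B by rewrite inE; right.
      have : U (exist _ x xB) by [].
      by rewrite UV.
    have [y [Ay Vy]] := clAx V (open_nbhs_nbhs (conj oV Vx)).
    have yB : y \in B by rewrite inE; left.
    have : U (exist _ y yB) by rewrite UV.
    by move=> /= yx; apply: nAx; rewrite -yx.
  have bP n : exists b, mdist a b < n.+1%:R^-1 /\ A (xi b).
    by apply: aP; rewrite invr_gt0.
  have [b bE] := choice bP; exists (xi \o b); split=> [n|]; first exact: (bE n).2.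
  move=> W; rewrite nbhsE => -[V [oV Vx] VW].
  have [|e e0 eV] := @resolution_near a V (open_sequentially_open oV); first by rewrite ax.
  have [N N1] := @archi_div R 1 e ler01 e0; exists N => // n /= Nn.
  apply/VW/eV; apply: lt_trans (bE n).1 (le_lt_trans _ N1).
  by rewrite mul1r lef_pV2 ?posrE// ler_nat ltnS.
split=> [|A]; first exact: resolution_surjective.
split=> [[y yA]|U].
  have [a ay] := resolution_surjective y.
  have aA : a \in xi @^-1` A by rewrite inE /= ay; exact: set_mem.
  by exists (exist _ a aA); apply/val_inj.
split=> [/open_set_type[V oV ->]|/open_set_type[W oW UW]]; apply/open_set_type.
  by exists (xi @^-1` V) => //; apply/resolution_openP/open_sequentially_open.
(* It suffices that no point [y] of [U] is in the closure of [Z]. Otherwise a sequence in [Z]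
   converges to [y] and lifts to points near some [a] over [y], so that one of them falls into the
   open set [W]. *)
pose Z := \val @` (~` U).
exists (~` closure Z); first exact/closed_openC/closed_closure.
apply/seteqP; split=> y; last first.
  move=> nZ; apply: contrapT => nUy; apply: nZ; apply: subset_closure.
  by exists y.
move=> Uy /FU[u [Zu uy]].
have [a [ay aP]] := resolution_lift_seq uy.
have aA : a \in xi @^-1` A by rewrite inE /= ay; exact: set_valP.
have restrE w (wA : w \in xi @^-1` A) (z : A) : xi w = \val z ->
    restr (exist _ w wA : xi @^-1` A) = z.
  by move=> wz; apply/val_inj.
have Wa : W a.
  have : (@restr _ _ xi A @^-1` U) (exist _ a aA) by rewrite /= (restrE _ _ y).
  by rewrite UW.
have [e e0 eW] := (metric_openP W).1 oW a Wa.
have [N /(_ N (leqnn _))[b bN ab]] := aP e e0.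
have [z nUz zN] := Zu N.
have bA : b \in xi @^-1` A by rewrite inE /= bN -zN; exact: set_valP.
have : (@restr _ _ xi A @^-1` U) (exist _ b bA) by rewrite UW; exact: eW.
by rewrite /= (restrE _ _ z)// bN.
Qed.

Lemma resolution_locally_sequence a : exists U : set E, nbhs a U /\
  exists C : set X, convergent_sequence R C /\ xi @` U `<=` C.
Proof.
have [e e0 eP] := compression_near (coord 0 a).
have m0 : 0 < Num.min e 1 / 1%:R by rewrite divr1 lt_min e0 ltr01.
exists (ball a (Num.min e 1 / 1%:R)); split; first exact: nbhsx_ballx.
(* [C] is the range of the map stored in the base point of [a]. The radius is at most 1, so a nearby
   base point has the same value or carries the same map. *)
exists (range (compression_omega a).1); split; first by eexists.
move=> _ [b ab <-]; rewrite ballEmdist /= in ab.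
move: ab => /coord_dist_le; rewrite lt_min => /andP[/eP ab ab1].
rewrite /resolution_map /compression_omega -/(coord 0 a) -/(coord 0 b) /calc.
case: ab => [->|[_ /le_lt_trans/(_ ab1)]]; first by eexists.
move=> /decomp_dist_lt1; rewrite /calc => -[<-|[-> _]]; by eexists.
Qed.

End resolution_topology.

Theorem theorem9p1 (R : realType) (X : topologicalType) :
  (economical (resolution R X) /\ complete_space (resolution R X) /\
   [set: resolution R X] #<= [set: R * (nat -> X)]) /\
  (monotone_map (@resolution_map_s R X) /\
   quotient_map (@resolution_map_s R X)) /\
  (connected [set: resolution R X] <-> connected [set: seq_coreflexion X]) /\
  (quotient_map (@resolution_map R X) <-> sequential_space X) /\
  (hereditarily_quotient_map (@resolution_map R X) <->
   Frechet_Urysohn_space X) /\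
  (forall a : resolution R X, exists U : set (resolution R X), nbhs a U /\
     exists C : set X, convergent_sequence R C /\
       @resolution_map R X @` U `<=` C).
Proof.
split; [split; [exact: omega_economical|split]|split; [split|split; [|split; [|split]]]].
- exact: omega_complete.
- exact: card_resolution.
- exact: resolution_monotone_s.
- exact: resolution_quotient_s.
- exact: (monotone_quotient_connected (@resolution_monotone_s R X)
    (resolution_quotient_s R X)).
- exact: resolution_quotientP.
- exact: resolution_hereditarily_quotientP.
- exact: resolution_locally_sequence.
Qed.
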